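(* Let $H$ be a forest with connected components the trees $T_1,\dots,T_k$, and let $b$ be a positive integer. Consider $(1:b)$ Client-Waiter vertex games. (1) If $H$ is a tree ($k=1$), there exists a tree $T$ such that Client wins the $(1:b)$ Client-Waiter vertex $H$-game played on $T$. (2) For each $i\in[k]$ let $T^{(i)}_{\min}$ be a tree with the minimum number of vertices such that Client wins the $(1:b)$ Client-Waiter vertex $T_i$-game played on it, and let $T_{\max}$ be one of the trees $T^{(i)}_{\min}$ with the maximum number of vertices; write $v=v(T_{\max})$, $e=e(T_{\max})$. Then for $G\sim G(n,p)$: if $p=\omega(n^{-v/e})$ then w.h.p. Client wins the $(1:b)$ Client-Waiter vertex $H$-game on $G$, and if $p=o(n^{-v/e})$ then w.h.p. Waiter wins it.
   Context: The $(1:b)$ Client-Waiter vertex $H$-game on a graph $G$: in each round Waiter offers a set of $t$ previously unclaimed vertices with $1\le t\le b+1$; Client claims one of them and Waiter claims the rest; in the last round Client claims one of the remaining vertices and Waiter the rest. Client wins if the subgraph of $G$ induced by his vertices contains a (not necessarily induced) copy of $H$; otherwise Waiter wins. $G(n,p)$ is the binomial random graph; ''w.h.p.'' means with probability tending to 1 as $n\to\infty$.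
   Formalization: Part (2) is stated for forests H with at least one edge; for an edgeless H every minimal tree is a single vertex, so e(T_max)=0 and n^{-v/e} is undefined. *)

(* Defs.v *)
From Stdlib Require Import Reals.
From mathcomp Require Import all_boot.
Set Implicit Arguments. Unset Strict Implicit. Unset Printing Implicit Defensive.

Definition simple_graph (V : finType) (e : rel V) : Prop :=
  (forall x y, e x y = e y x) /\ (forall x, e x x = false).

Definition has_cycle (V : finType) (e : rel V) : Prop :=
  exists s : seq V, [/\ uniq s, 3 <= size s & cycle e s].

Definition is_forest (V : finType) (e : rel V) : Prop :=
  simple_graph e /\ ~ has_cycle e.

Definition is_tree (V : finType) (e : rel V) : Prop :=
  is_forest e /\ 0 < #|V| /\ (forall x y, connect e x y).

Definition nedges (V : finType) (e : rel V) : nat :=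
  #|[set p : V * V | e p.1 p.2]| %/ 2.

Definition component (V : finType) (e : rel V) (x : V) : {set V} :=
  [set y | connect e x y].

(* The host graph (VG, eG) restricted to the vertex set C contains a (not
   necessarily induced) copy of the subgraph of (VH, eH) induced on A. *)
Definition has_copy (VH : finType) (eH : rel VH) (A : {set VH})
    (VG : finType) (eG : rel VG) (C : {set VG}) : bool :=
  [exists f : {ffun VH -> VG},
     [forall x in A, f x \in C] &&
     [forall x in A, forall y in A,
        ((f x == f y) ==> (x == y)) && (eH x y ==> eG (f x) (f y))]].

(* (1:b) Client-Waiter vertex game.  State: Client's vertices C, free vertices F.
   While F is nonempty, Waiter offers O ⊆ F with 1 <= |O| <= b+1, Client claims
   one x ∈ O and Waiter claims O \ {x}.  Client wins iff at the end his
   vertices contain a copy of the target.  [fuel] bounds the number of rounds. *)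
Fixpoint cw_client_wins (b : nat) (VH : finType) (eH : rel VH) (A : {set VH})
    (VG : finType) (eG : rel VG) (fuel : nat) (C F : {set VG}) : bool :=
  match fuel with
  | 0 => has_copy eH A eG C
  | fuel'.+1 =>
      if F == set0 then has_copy eH A eG C
      else [forall O : {set VG},
              ((O \subset F) && (0 < #|O| <= b.+1)) ==>
              [exists x in O, cw_client_wins b eH A eG fuel' (x |: C) (F :\: O)]]
  end.

Definition client_wins (b : nat) (VH : finType) (eH : rel VH) (A : {set VH})
    (VG : finType) (eG : rel VG) : bool :=
  cw_client_wins b eH A eG #|VG| set0 setT.

Definition min_winning_tree (b : nat) (VH : finType) (eH : rel VH) (A : {set VH})
    (VT : finType) (eT : rel VT) : Prop :=
  [/\ is_tree eT, client_wins b eH A eT &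
      forall (VT' : finType) (eT' : rel VT'),
        is_tree eT' -> client_wins b eH A eT' -> #|VT| <= #|VT'| ].

Definition epair (n : nat) := {p : 'I_n * 'I_n | (p.1 < p.2)%N}.

Definition gadj (n : nat) (E : {set epair n}) : rel 'I_n :=
  fun i j => [exists u in E,
                (((val u).1 == i) && ((val u).2 == j)) ||
                (((val u).1 == j) && ((val u).2 == i))].

Definition gnp_prob (n : nat) (p : R) (Q : pred {set epair n}) : R :=
  \big[Rplus/R0]_(E : {set epair n} | Q E)
     Rmult (pow p #|E|) (pow (Rminus R1 p) (subn #|[set: epair n]| #|E|)).

Definition whp (Q : forall n : nat, pred {set epair n}) (p : nat -> R) : Prop :=
  Un_cv (fun n => @gnp_prob n (p n) (Q n)) R1.

Definition little_omega (p f : nat -> R) : Prop :=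
  forall M : R, Rlt R0 M ->
    exists N : nat, forall n, (N <= n)%nat -> Rle (Rmult M (f n)) (p n).
Definition little_o (p f : nat -> R) : Prop :=
  forall eps : R, Rlt R0 eps ->
    exists N : nat, forall n, (N <= n)%nat -> Rle (p n) (Rmult eps (f n)).

Definition threshold (v e : nat) : nat -> R :=
  fun n => Rpower (INR n) (Ropp (Rdiv (INR v) (INR e))).

Definition prob_bounds (p : nat -> R) : Prop :=
  forall n, Rle R0 (p n) /\ Rle (p n) R1.

(* Main.v *)
Require Import Defs.
From Stdlib Require Import Reals Classical.
From mathcomp Require Import all_boot all_order ssralg ssrnum archimedean rat.
From mathcomp Require Import zify ring lra.
From mathcomp Require Import Rstruct.
Set Implicit Arguments. Unset Strict Implicit. Unset Printing Implicit Defensive.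
Import Order.TTheory GRing.Theory Num.Theory.

(** Several boards.  Suppose that Client can win on each of many small disjoint boards of
    several kinds, and let him answer in a uniformly random touched board, following his
    strategy there.  A board with at most v vertices is then won with probability at
    least (b+1)^(-v), so that with positive probability he wins a board of every kind.
    Choosing each answer so as not to increase the expected number of kinds without a won
    board makes this deterministic.  He can moreover win one further board for certain,
    by answering there whenever it is touched: this happens boundedly often.

    Trees.  A tree H is built by adding leaves.  If Client wins the game for H - x on T,
    where x is a leaf of H, attach many leaves to every vertex of T.  With T as the
    further board and the new leaves as one-vertex boards, Client wins on T and claims a
    leaf at every vertex of T, and one of these leaves extends his copy of H - x.

    Random graphs.  A tree with v vertices has v - 1 edges.  If p << n^(-v/(v-1)), then
    by a first moment computation w.h.p. all components of G(n,p) are trees with fewer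
    than v vertices.  Waiter plays the components one by one, and by minimality of v
    Client gets a copy of the critical component of H in none of them.  If
    p >> n^(-v/(v-1)), then by a second moment computation w.h.p. G(n,p) contains any
    given number of disjoint copies of all the minimum winning trees; these are the
    boards, and their kinds are the components of H. *)

(** * Finite sets and inequalities *)

Lemma setIU1_in (T : finType) (C D : {set T}) x :
  x \in D -> (x |: C) :&: D = x |: (C :&: D).
Proof. by move=> xD; rewrite setIUl (setIidPl _) ?sub1set. Qed.

Lemma setDI_restr (T : finType) (D F O : {set T}) :
  (F :\: O) :&: D = (F :&: D) :\: (O :&: D).
Proof. by apply/setP => y; rewrite !inE; do !case: (y \in _). Qed.

Lemma preimset_imsetK (U V : finType) (f : U -> V) (A : {set U}) :
  injective f -> f @^-1: (f @: A) = A.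
Proof. by move=> f_inj; apply/setP => x; rewrite inE mem_imset. Qed.

Lemma imsetD_inj (U V : finType) (f : U -> V) (A B : {set U}) :
  injective f -> f @: (A :\: B) = f @: A :\: f @: B.
Proof.
move=> f_inj; apply/setP => y; rewrite inE.
apply/imsetP/andP => [[x]|[yB /imsetP[x xA yx]]].
  by rewrite inE => /andP[xB xA] ->; rewrite mem_imset // xB imset_f.
by exists x; rewrite // inE xA andbT; apply: contraNN yB; rewrite yx; apply: imset_f.
Qed.

Lemma card_set_sum (T : finType) (A : {set T}) (P : pred T) :
  #|[set x in A | P x]| = \sum_(x in A) P x.
Proof. by rewrite -sum1_card -big_mkcondr; apply: eq_bigl => x; rewrite inE. Qed.

Lemma card_fst_fiber (I J : finType) (i : I) : #|[set p : I * J | p.1 == i]| = #|J|.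
Proof.
rewrite -(mul1n #|J|) -cardsT -(cards1 i) -cardsX.
by apply: eq_card => p; rewrite !inE andbT.
Qed.

Lemma imset_val_setT (T : finType) (A : {set T}) : val @: [set: {x | x \in A}] = A.
Proof.
apply/setP => x; apply/imsetP/idP => [[u _ ->]|xA]; first exact: (valP u).
by exists (Sub x xA); rewrite ?SubK ?inE.
Qed.

Lemma existT_inj (K : eqType) (U : K -> eqType) k : injective (existT U k).
Proof. by move=> a c /eqP; rewrite eq_Tagged => /eqP. Qed.

Lemma disjoint_imset_existT (K : finType) (U : K -> finType) k l :
  k != l -> [disjoint existT U k @: setT & existT U l @: setT].
Proof.
move=> kl; rewrite -setI_eq0; apply/eqP/setP => z; rewrite !inE.
apply: contraNF kl => /andP[/imsetP[a _ ->] /imsetP[c _ eq_kl]].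
by rewrite -[k]/(tag (existT U k a)) eq_kl.
Qed.

Lemma bin_leq_exp n m : 'C(n, m) <= n ^ m.
Proof.
elim: m => [|m IH]; first by rewrite bin0.
apply: leq_trans (leq_pmull _ (ltn0Sn m)) _.
by rewrite mul_bin_left expnS leq_mul // leq_subr.
Qed.

Section Inequalities.
Local Open Scope ring_scope.

Lemma prodr_1B_ge (R : realDomainType) (I : finType) (P : pred I) (q : I -> R) :
  (forall i, 0 <= q i <= 1) -> 1 - \sum_(i | P i) q i <= \prod_(i | P i) (1 - q i).
Proof.
move=> q01; suff /andP[] : 1 - \sum_(i | P i) q i <= \prod_(i | P i) (1 - q i) <= 1 by [].
elim/big_rec2: _ => [|i s x _ /andP[lo hi]]; first by rewrite subr0 lexx.
have /andP[q0 q1] := q01 i; apply/andP; split; nra.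
Qed.

Lemma prodr_1B_ge0 (R : numDomainType) (I : finType) (P : pred I) (q : I -> R) :
  (forall i, 0 <= q i <= 1) -> 0 <= \prod_(i | P i) (1 - q i).
Proof. by move=> q01; apply: prodr_ge0 => i _; rewrite subr_ge0; case/andP: (q01 i). Qed.

Lemma exists_le_mean (R : realDomainType) (I : finType) (T : {set I}) (f : I -> R) c :
  T != set0 -> \sum_(i in T) f i <= #|T|%:R * c -> exists2 i, i \in T & f i <= c.
Proof.
move=> /set0Pn[i0 i0T] le_sum; apply/exists_inP; apply: contraLR le_sum.
rewrite negb_exists_in -ltNge mulr_natl -sumr_const => /forall_inP gtc.
apply: ltr_sum => [|i /gtc]; last by rewrite ltNge.
by apply/hasP; exists i0; rewrite ?mem_index_enum.
Qed.

Lemma exprn_1B_mul_1D_le1 (R : realDomainType) (c : R) n :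
  0 <= c <= 1 -> (1 - c) ^+ n * (1 + n%:R * c) <= 1.
Proof.
move=> /andP[c0 c1]; elim: n => [|n]; first by rewrite expr0 mul0r addr0 mulr1.
apply: le_trans; rewrite exprSr -mulrA ler_wpM2l ?exprn_ge0 ?subr_ge0 //.
have n0 : 0 <= n%:R :> R by apply: ler0n.
rewrite -natr1; nra.
Qed.

Lemma exists_mul_expr_lt1 (R : archiRealFieldType) (c x : R) : 0 < c <= 1 ->
  exists n : nat, x * (1 - c) ^+ n < 1.
Proof.
move=> /andP[c0 c1]; have [x0|x0] := lerP x 0.
  by exists 0; rewrite expr0 mulr1 (le_lt_trans x0).
exists (Num.bound (x / c)); set n := Num.bound _.
have xnc : x < n%:R * c by rewrite -ltr_pdivrMr // archi_boundP // divr_ge0 // ltW.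
have := @exprn_1B_mul_1D_le1 R c n; rewrite c1 ltW // => /(_ isT) le1.
have := exprn_ge0 n (x := 1 - c); rewrite subr_ge0 c1 => /(_ isT) ge0.
nra.
Qed.

End Inequalities.

(** * Client-Waiter games *)

Definition offers (b : nat) (V : finType) (F : {set V}) : {set {set V}} :=
  [set O : {set V} | (O \subset F) && (0 < #|O| <= b.+1)].

Fixpoint forces_within (b : nat) (V : finType) (W : pred {set V}) (fuel : nat)
    (C F : {set V}) : bool :=
  match fuel with
  | 0 => W C
  | fuel'.+1 =>
      if F == set0 then W C
      else [forall O in offers b F, [exists x in O,
              forces_within b W fuel' (x |: C) (F :\: O)]]
  end.

(* Every round uses up a free vertex, so #|F| rounds suffice. *)
Definition forces (b : nat) (V : finType) (W : pred {set V}) (C F : {set V}) : bool :=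
  forces_within b W #|F| C F.

Definition forces_on (b : nat) (V : finType) (W : pred {set V})
    (D C F : {set V}) : bool :=
  forces b W (C :&: D) (F :&: D).

Definition monotone (V : finType) (W : pred {set V}) : Prop :=
  forall C C' : {set V}, C \subset C' -> W C -> W C'.

Section Game.
Variables (b : nat) (V : finType).
Implicit Types (W : pred {set V}) (C D F O : {set V}).

Lemma offersP F O :
  reflect [/\ O \subset F, O != set0 & #|O| <= b.+1] (O \in offers b F).
Proof. by rewrite inE card_gt0; apply: and3P. Qed.

Lemma card_setD_offer F O : O \in offers b F -> #|F :\: O| < #|F|.
Proof.
case/offersP=> sOF O0 _; rewrite cardsDS // ltn_subrL card_gt0 O0 /=.
by apply: leq_trans (subset_leq_card sOF); rewrite card_gt0.
Qed.

Lemma forces_within_fuel W m n C F : #|F| <= m -> #|F| <= n ->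
  forces_within b W m C F = forces_within b W n C F.
Proof.
elim: m n C F => [|m IH] [|n] C F //=; rewrite ?leqn0 ?cards_eq0.
- by move=> ->.
- by move=> _ ->.
move=> Fm Fn; case: eqP => // _; apply: eq_forallb_in => O /card_setD_offer ltFO.
by apply: eq_existsb_in => x _; apply: IH; rewrite -ltnS (leq_trans ltFO).
Qed.

Lemma forces0 W C : forces b W C set0 = W C.
Proof. by rewrite /forces cards0. Qed.

Lemma forcesE W C F : F != set0 ->
  forces b W C F =
    [forall O in offers b F, [exists x in O, forces b W (x |: C) (F :\: O)]].
Proof.
move=> F0; rewrite {1}/forces -[#|F|]prednK ?card_gt0 //= (negPf F0).
apply: eq_forallb_in => O /card_setD_offer ltFO; apply: eq_existsb_in => x _.
by apply: forces_within_fuel; rewrite // -ltnS prednK ?card_gt0.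
Qed.

Lemma offer_nonempty F O : O \in offers b F -> F != set0.
Proof.
by case/offersP=> sOF O0 _; apply: contraNneq O0 => F0; rewrite -subset0 -F0.
Qed.

Lemma forces_reply W C F O : forces b W C F -> O \in offers b F ->
  exists2 x, x \in O & forces b W (x |: C) (F :\: O).
Proof.
move=> winW OF; move: winW; rewrite forcesE ?(offer_nonempty OF) //.
by move/forall_inP/(_ O OF)/exists_inP.
Qed.

Lemma not_forces_offer W C F : F != set0 -> ~~ forces b W C F ->
  exists2 O, O \in offers b F & {in O, forall x, ~~ forces b W (x |: C) (F :\: O)}.
Proof.
move=> F0; rewrite forcesE // negb_forall_in => /exists_inP[O OF].
by rewrite negb_exists_in => /forall_inP loseO; exists O.
Qed.

Lemma forces_invariant (P : {set V} -> {set V} -> Prop) W C F :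
  (forall C, P C set0 -> W C) ->
  (forall C F O, P C F -> O \in offers b F ->
     exists2 x, x \in O & P (x |: C) (F :\: O)) ->
  P C F -> forces b W C F.
Proof.
move=> P_end P_round; have [n] := ubnP #|F|; elim: n C F => // n IH C F Fn PCF.
have [F0|F0] := eqVneq F set0; first by rewrite F0 forces0; apply: P_end; rewrite -F0.
rewrite forcesE //; apply/forall_inP => O OF; apply/exists_inP.
have [x xO Px] := P_round _ _ _ PCF OF; exists x => //; apply: IH Px.
exact: leq_trans (card_setD_offer OF) _.
Qed.

Lemma forces_sub W W' C F :
  (forall C, W C -> W' C) -> forces b W C F -> forces b W' C F.
Proof.
move=> WW'; apply: (@forces_invariant (forces b W)) => [C0|C0 F0 O].
  by rewrite forces0; apply: WW'.
exact: forces_reply.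
Qed.

Lemma forces_sat W C F : forces b W C F -> exists C', W C'.
Proof.
move=> winW; apply/existsP; apply: contraLR winW => /existsPn noW.
have [n] := ubnP #|F|; elim: n C F => // n IH C F Fn.
have [->|/set0Pn[y yF]] := eqVneq F set0; first by rewrite forces0.
have yO : [set y] \in offers b F by rewrite inE sub1set yF cards1.
apply/negP => /forces_reply /(_ yO)[x _]; apply/negP/IH.
exact: leq_trans (card_setD_offer yO) _.
Qed.

Lemma forces_mem x : forces b (fun C => x \in C) set0 [set x].
Proof.
pose P (C F : {set V}) := (F \subset [set x]) && (x \in C :|: F).
apply: (@forces_invariant P); rewrite /P ?subxx ?set0U ?set11 //.
  by move=> C; rewrite setU0 => /andP[].
move=> C F O /andP[Fx _] /offersP[sOF /set0Pn[y yO] _]; exists y => //.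
have /set1P -> := subsetP Fx y (subsetP sOF y yO).
by rewrite !inE eqxx andbT (subset_trans _ Fx) // subsetDl.
Qed.

Lemma offers_restr D F O :
  O \in offers b F -> O :&: D != set0 -> O :&: D \in offers b (F :&: D).
Proof.
move=> /offersP[sOF _ Ob] OD0; apply/offersP; split; rewrite ?setSI //.
exact: leq_trans (subset_leq_card (subsetIl _ _)) Ob.
Qed.

Lemma card_setD_offer_on D F O : O \in offers b F -> O :&: D != set0 ->
  #|(F :\: O) :&: D| < #|F :&: D|.
Proof. by move=> OF OD0; rewrite setDI_restr; apply/card_setD_offer/offers_restr. Qed.

Lemma forces_on_reply W D C F O :
  forces_on b W D C F -> O \in offers b F -> O :&: D != set0 ->
  exists2 x, x \in O :&: D & forces_on b W D (x |: C) (F :\: O).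
Proof.
move=> winD OF OD0; have [x xOD winx] := forces_reply winD (offers_restr OF OD0).
exists x => //.
by rewrite /forces_on setDI_restr setIU1_in //; case/setIP: xOD.
Qed.

Lemma forces_on_untouched W D C F O x : x \in O -> O :&: D = set0 ->
  forces_on b W D (x |: C) (F :\: O) = forces_on b W D C F.
Proof.
move=> xO OD0; rewrite /forces_on setDI_restr OD0 setD0; congr (forces b W _ _).
apply/setP => y; rewrite !inE; case: eqVneq => // ->.
by have := in_set0 x; rewrite -OD0 inE xO /= => ->; rewrite andbF.
Qed.

Lemma forces_on_start W D F : D \subset F -> forces_on b W D set0 F = forces b W set0 D.
Proof. by move=> DF; rewrite /forces_on set0I (setIidPr DF). Qed.

Lemma forces_subset W D F : monotone W -> D \subset F ->
  forces b W set0 D -> forces b W set0 F.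
Proof.
move=> mW DF; rewrite -(forces_on_start W DF).
apply: (@forces_invariant (forces_on b W D)) => [C|C F0 O winD OF].
  by rewrite /forces_on set0I forces0; apply: mW; apply: subsetIl.
have [OD0|OD0] := eqVneq (O :&: D) set0.
  have [_ /set0Pn[x xO] _] := offersP _ _ OF.
  by exists x; rewrite // forces_on_untouched.
by have [x /setIP[xO _] winx] := forces_on_reply winD OF OD0; exists x.
Qed.

(* Contrapositively: Waiter, offering part of the class of any free vertex by a strategy
   that wins him that class, keeps every class lost for Client. *)
Lemma forces_class (K : eqType) (r : V -> K) W C F :
  (forall C, W C -> exists y, W (C :&: [set x | r x == r y])) ->
  forces b W C F -> exists y, forces_on b W [set x | r x == r y] C F.
Proof.
move=> W_class; have [n] := ubnP #|F|; elim: n C F => // n IH C F Fn winF.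
have [F0|/set0Pn[y yF]] := eqVneq F set0.
  move: winF; rewrite F0 forces0 => /W_class[z Wz].
  by exists z; rewrite /forces_on set0I forces0.
set D := [set x | r x == r y].
have [winD|loseD] := boolP (forces_on b W D C F); first by exists y.
have FD0 : F :&: D != set0 by apply/set0Pn; exists y; rewrite !inE yF eqxx.
have [O OFD loseO] := not_forces_offer FD0 loseD.
have [sOFD O0 Ob] := offersP _ _ OFD; have [sOF sOD] := subsetIP sOFD.
have OF : O \in offers b F by apply/offersP.
have [x xO winx] := forces_reply winF OF.
have [z winz] := IH _ _ (leq_trans (card_setD_offer OF) Fn) winx.
have [zD|zD] := eqVneq (r z) (r y).
  have := loseO x xO; move: winz; rewrite zD -/D /forces_on.
  by rewrite setDI_restr (setIidPl sOD) setIU1_in ?(subsetP sOD) // => ->.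
exists z; move: winz; rewrite forces_on_untouched //.
apply/setP => w; rewrite !inE; apply: contraNF zD.
by case/andP=> /(subsetP sOD); rewrite inE => /eqP <-; rewrite eq_sym.
Qed.

End Game.

Lemma offers_imset (b : nat) (U V : finType) (f : U -> V) (F O : {set U}) :
  injective f -> (f @: O \in offers b (f @: F)) = (O \in offers b F).
Proof.
move=> f_inj; rewrite !inE card_imset //; congr (_ && _).
apply/idP/idP; last exact: imsetS.
move=> /subsetP sOF; apply/subsetP => x xO; rewrite -(mem_imset _ _ f_inj).
by apply: sOF; apply: imset_f.
Qed.

Lemma forces_imset (b : nat) (U V : finType) (f : U -> V) (W : pred {set V})
    (C F : {set U}) : injective f ->
  forces b W (f @: C) (f @: F) = forces b (fun C0 : {set U} => W (f @: C0)) C F.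
Proof.
move=> f_inj; apply/idP/idP => winW.
  pose P (C0 F0 : {set U}) := forces b W (f @: C0) (f @: F0).
  apply: (@forces_invariant b U P) => // [C0|C0 F0 O winf OF].
    by rewrite /P imset0 forces0.
  have [_ /imsetP[x xO ->] winx] : exists2 y, y \in f @: O &
      forces b W (y |: f @: C0) (f @: F0 :\: f @: O).
    by apply: forces_reply => //; rewrite offers_imset.
  by exists x; rewrite // /P imsetU1 imsetD_inj.
pose P (C1 F1 : {set V}) := exists (C0 F0 : {set U}),
  [/\ C1 = f @: C0, F1 = f @: F0 & forces b (fun C0 : {set U} => W (f @: C0)) C0 F0].
apply: (@forces_invariant b V P) => [C1|C1 F1 O|]; last by exists C, F.
  move=> [C0 [F0 [-> /esym/eqP]]]; rewrite imset_eq0 => /eqP ->.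
  by rewrite forces0.
move=> [C0 [F0 [-> -> win0]]] OF.
have defO : f @: (f @^-1: O) = O.
  apply/setP => y; apply/imsetP/idP => [[x + ->]|yO]; first by rewrite inE.
  have [sOF _ _] := offersP _ _ _ OF; have /imsetP[x _ yx] := subsetP sOF y yO.
  by exists x; rewrite // inE -yx.
rewrite -defO in OF *; rewrite offers_imset // in OF.
have [x xO winx] := forces_reply win0 OF; exists (f x); first exact: imset_f.
by exists (x |: C0), (F0 :\: f @^-1: O); rewrite imsetU1 imsetD_inj.
Qed.

(** * Winning a board of every kind *)

Section Failure.
Local Open Scope ring_scope.
Variables (R : realFieldType) (I K : finType) (kind : I -> K).
Implicit Types (q : I -> R) (T : {set I}).

(* The expected number of kinds without a success when the boards succeed
   independently, board i with probability q i. *)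
Definition failure q : R := \sum_k \prod_(i | kind i == k) (1 - q i).

(* The chances after a reply in the touched board i: the other touched boards are
   given up. *)
Definition favour (m : nat) T i q : I -> R :=
  fun j => if j \notin T then q j else if j == i then m%:R * q j else 0.

Lemma failure_ge0 q : (forall i, 0 <= q i <= 1) -> 0 <= failure q.
Proof. by move=> q01; apply: sumr_ge0 => k _; apply: prodr_1B_ge0. Qed.

Lemma failure_le q q' : (forall i, q i <= q' i <= 1) -> failure q' <= failure q.
Proof.
move=> qq'; apply: ler_sum => k _; apply: ler_prod => i _.
by have /andP[le1 le2] := qq' i; rewrite subr_ge0 le2 lerD2l lerN2.
Qed.

Lemma failure_lt1 q k : (forall i, 0 <= q i <= 1) -> failure q < 1 ->
  exists2 i, kind i == k & q i != 0.
Proof.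
move=> q01 lt1; apply/exists_inP; apply: contraLR lt1.
rewrite negb_exists_in -leNgt => /forall_inP q0.
rewrite /failure (bigD1 k) //= big1 => [|i /q0]; last first.
  by rewrite negbK => /eqP ->; rewrite subr0.
by rewrite lerDl; apply: sumr_ge0 => l _; apply: prodr_1B_ge0.
Qed.

Lemma failure_uniform_le c N q : 0 <= c <= 1 -> (forall i, c <= q i <= 1) ->
  (forall k, (N <= #|[set i | kind i == k]|)%N) ->
  failure q <= #|K|%:R * (1 - c) ^+ N.
Proof.
move=> /andP[c0 c1] cq kindN; rewrite mulr_natl -sumr_const; apply: ler_sum => k _.
apply: (@le_trans _ _ (\prod_(i | kind i == k) (1 - c))).
  apply: ler_prod => i _; have /andP[cqi qi1] := cq i.
  by rewrite subr_ge0 qi1 lerD2l lerN2.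
rewrite prodr_const -cardsE; apply: ler_wiXn2l; rewrite ?kindN //; lra.
Qed.

Lemma failure_loss q T : (forall i, 0 <= q i <= 2^-1) ->
  failure (fun i => if i \in T then 0 else q i) <= 2 ^+ #|T| * failure q.
Proof.
move=> q01; rewrite mulr_sumr; apply: ler_sum => k _.
apply: le_trans
  (_ : \prod_(i | kind i == k) ((if i \in T then 2 else 1) * (1 - q i)) <= _).
  apply: ler_prod => i _; have /andP[q0 q2] := q01 i.
  by case: ifP => _; apply/andP; split; lra.
rewrite big_split /= ler_wpM2r //.
  by apply: prodr_ge0 => i _; rewrite subr_ge0; have /andP[_] := q01 i; lra.
rewrite -big_mkcondr prodr_const ler_weXn2l ?ler1n //.
by apply: subset_leq_card; apply/subsetP => i /andP[].
Qed.

Lemma sum_prod_favour_le m T q k : (#|T| <= m)%N -> (forall i, 0 <= q i <= 1) ->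
  \sum_(i in T) \prod_(j | kind j == k) (1 - favour m T i q j) <=
    #|T|%:R * \prod_(j | kind j == k) (1 - q j).
Proof.
move=> Tm q01; pose rest := \prod_(j | (kind j == k) && (j \notin T)) (1 - q j).
have rest0 : 0 <= rest by apply: prodr_1B_ge0.
have favourE i : i \in T -> \prod_(j | kind j == k) (1 - favour m T i q j) =
    (1 - (if kind i == k then m%:R * q i else 0)) * rest.
  move=> iT; rewrite (bigID (mem T)) /=; congr (_ * _); last first.
    by apply: eq_bigr => j /andP[_ jT]; rewrite /favour jT.
  have other j : j != i -> j \in T -> 1 - favour m T i q j = 1.
    by move=> /negPf ji jT; rewrite /favour jT ji subr0.
  case: ifP => ik; first rewrite (bigD1 i) /= ?ik // /favour iT eqxx big1 ?mulr1 //.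
    by move=> j /andP[/andP[_ jT] ji]; apply: other.
  rewrite subr0 big1 // => j /andP[jk jT]; apply: other => //.
  by apply: contraTneq jk => ->; rewrite ik.
rewrite (eq_bigr _ favourE) -mulr_suml [X in _ <= _ * X](bigID (mem T)) /= mulrA.
apply: ler_wpM2r => //; rewrite sumrB sumr_const -big_mkcondr /= -mulr_sumr.
set s := \sum_(i in T | _) q i.
have s0 : 0 <= s by apply: sumr_ge0 => i _; case/andP: (q01 i).
have Tms : #|T|%:R * s <= m%:R * s by rewrite ler_wpM2r ?ler_nat.
apply: (@le_trans _ _ (#|T|%:R * (1 - s))); first by rewrite mulrBr mulr1 lerD2l lerN2.
apply: ler_wpM2l; first exact: ler0n.
by rewrite /s (eq_bigl _ _ (fun i => andbC _ _)) prodr_1B_ge.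
Qed.

(* Averaging over i in T: the method of conditional expectations for the Client who
   replies in a uniformly random touched board. *)
Lemma exists_favour_le m T q : T != set0 -> (#|T| <= m)%N ->
  (forall i, 0 <= q i <= 1) ->
  exists2 i, i \in T & failure (favour m T i q) <= failure q.
Proof.
move=> T0 Tm q01; apply: exists_le_mean T0 _.
rewrite exchange_big mulr_sumr; apply: ler_sum => k _.
exact: sum_prod_favour_le.
Qed.

End Failure.

Definition touched (V I : finType) (B : I -> {set V}) (O : {set V}) : {set I} :=
  [set i | O :&: B i != set0].

Lemma card_touched_le (V I : finType) (B : I -> {set V}) (O : {set V}) :
  (forall i j, i != j -> [disjoint B i & B j]) -> #|touched B O| <= #|O|.
Proof.
move=> disjB; pose board x := [pick i | x \in B i].
have boardE x i : x \in B i -> board x = Some i.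
  rewrite /board; case: pickP => [j xj xi|/(_ i) -> //]; congr Some.
  apply: contraTeq xj => /disjB /pred0P/(_ x) /=.
  by rewrite xi andbT => ->.
apply: leq_trans (leq_imset_card board (mem O)).
have Some_inj : injective (@Some I) by move=> ? ? [].
rewrite -(card_imset _ Some_inj); apply: subset_leq_card.
apply/subsetP => _ /imsetP[i + ->]; rewrite inE => /set0Pn[x /setIP[xO xB]].
by apply/imsetP; exists x; rewrite // (boardE _ _ xB).
Qed.

Section Boards.
Local Open Scope ring_scope.
Variables (b : nat) (V I K : finType) (kind : I -> K).
Variables (D : {set V}) (W0 : pred {set V}) (B : I -> {set V}) (W : I -> pred {set V}).
Hypothesis disjBB : forall i j, i != j -> [disjoint B i & B j].
Hypothesis disjDB : forall i, [disjoint D & B i].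
Implicit Types (C F O : {set V}).

(* A reply in a uniformly random touched board is in a given one of them with
   probability at least 1/(b+1), whence the power of b+1.  The factor 1/2 keeps the
   chances away from 1, so that a round played on D multiplies the failure by at most
   2^b. *)
Definition chance C F (i : I) : rat :=
  if forces_on b (W i) (B i) C F then (2 * b.+1%:R ^+ #|F :&: B i|)^-1 else 0.

Lemma chance_itv_half C F i : 0 <= chance C F i <= 2^-1.
Proof.
rewrite /chance; case: ifP => _; last by rewrite lexx.
rewrite invr_ge0 mulr_ge0 ?exprn_ge0 //= lef_pV2 ?posrE ?mulr_gt0 ?exprn_gt0 //.
by rewrite ler_peMr // exprn_ege1 // ler1n.
Qed.

Lemma chance_itv C F i : 0 <= chance C F i <= 1.
Proof. by have /andP[-> le] := chance_itv_half C F i; apply: le_trans le _. Qed.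

Lemma chance_untouched C F O x i : x \in O -> i \notin touched B O ->
  chance (x |: C) (F :\: O) i = chance C F i.
Proof.
move=> xO; rewrite inE negbK => /eqP OB0.
by rewrite /chance forces_on_untouched // setDI_restr OB0 setD0.
Qed.

Lemma chance_reply C F O i : O \in offers b F -> i \in touched B O ->
  exists2 x, x \in O & b.+1%:R * chance C F i <= chance (x |: C) (F :\: O) i.
Proof.
move=> OF; rewrite inE => OB0; rewrite {1}/chance; case: ifP => [winB|_]; last first.
  have [_ /set0Pn[x xO] _] := offersP _ _ _ OF; exists x => //.
  by rewrite mulr0; case/andP: (chance_itv (x |: C) (F :\: O) i).
have [x /setIP[xO _] winx] := forces_on_reply winB OF OB0; exists x => //.
rewrite /chance winx; have := card_setD_offer_on OF OB0.
case: #|F :&: B i| => // l; rewrite ltnS => le_l.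
rewrite exprS mulrCA invfM mulVKf ?pnatr_eq0 // lef_pV2 ?posrE ?mulr_gt0 ?exprn_gt0 //.
by rewrite ler_pM2l // ler_weXn2l // ler1n.
Qed.

Lemma failure_reply_on_boards C F O : O \in offers b F ->
  exists2 x, x \in O &
    failure kind (chance (x |: C) (F :\: O)) <= failure kind (chance C F).
Proof.
move=> OF; have [_ /set0Pn[x0 x0O] Ob] := offersP _ _ _ OF.
have [T0|T0] := eqVneq (touched B O) set0.
  exists x0 => //; apply: failure_le => i.
  by rewrite chance_untouched ?T0 ?inE // lexx; case/andP: (chance_itv C F i).
have [i iT le_fail] := exists_favour_le kind T0
  (leq_trans (card_touched_le O disjBB) Ob) (chance_itv C F).
have [x xO le_chance] := chance_reply C OF iT.
exists x => //; apply: le_trans le_fail; apply: failure_le => j.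
have /andP[ge0 ->] := chance_itv (x |: C) (F :\: O) j; rewrite andbT /favour.
by case: ifPn => [jT|_]; [rewrite chance_untouched | case: eqP => // ->].
Qed.

Lemma failure_reply_on_main C F O x : O \in offers b F -> x \in O :&: D ->
  failure kind (chance (x |: C) (F :\: O)) <= 2 ^+ b * failure kind (chance C F).
Proof.
move=> OF /setIP[xO xD]; have [_ _ Ob] := offersP _ _ _ OF.
have touchedE : touched B O = touched B (O :\ x).
  apply/setP => i; rewrite !inE setIDAC; congr (_ != _); apply/esym/setDidPl.
  by rewrite disjoint_sym disjoints1 inE xO (disjointFr (disjDB i) xD).
have Tb : (#|touched B O| <= b)%N.
  rewrite touchedE; apply: leq_trans (card_touched_le _ disjBB) _.
  by move: Ob; rewrite (cardsD1 x) xO.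
apply: le_trans (_ : 2 ^+ #|touched B O| * failure kind (chance C F) <= _); last first.
  by rewrite ler_wpM2r ?failure_ge0 // ?ler_weXn2l ?ler1n //; apply: chance_itv.
apply: le_trans (failure_loss kind (touched B O) (chance_itv_half C F)).
apply: failure_le => i; have /andP[ge0 ->] := chance_itv (x |: C) (F :\: O) i.
by rewrite andbT; case: ifPn => // iT; rewrite chance_untouched.
Qed.

Hypotheses (monoW0 : monotone W0) (monoW : forall i, monotone (W i)).

Lemma forces_boards_of_failure C F : forces_on b W0 D C F ->
  2 ^+ (b * #|F :&: D|) * failure kind (chance C F) < 1 ->
  forces b (fun C => W0 C && [forall k, [exists (i | kind i == k), W i C]]) C F.
Proof.
pose P C F := forces_on b W0 D C F /\
  2 ^+ (b * #|F :&: D|) * failure kind (chance C F) < 1.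
move=> winCF smallCF; apply: (@forces_invariant b V P) => // {C F winCF smallCF}.
  move=> C []; rewrite /forces_on set0I forces0 cards0 muln0 mul1r => W0C small.
  apply/andP; split; first exact: monoW0 (subsetIl C D) W0C.
  apply/forallP => k.
  have [i ik] := failure_lt1 k (chance_itv C set0) small.
  rewrite /chance /forces_on set0I forces0; case: ifP => [WiC _|]; last by rewrite eqxx.
  by apply/exists_inP; exists i => //; apply: monoW (subsetIl C (B i)) WiC.
move=> C F O [winD small] OF.
have [OD0|OD0] := eqVneq (O :&: D) set0.
  have [x xO le_fail] := failure_reply_on_boards C OF; exists x => //.
  split; first by rewrite forces_on_untouched.
  by apply: le_lt_trans small; rewrite setDI_restr OD0 setD0 ler_wpM2l ?exprn_ge0.
have [x xOD winx] := forces_on_reply winD OF OD0; exists x; first by case/setIP: xOD.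
split=> //; apply: le_lt_trans small.
have le_fail := failure_reply_on_main C OF xOD.
apply: (le_trans (ler_wpM2l _ le_fail)); rewrite ?exprn_ge0 // mulrA -exprD.
rewrite ler_wpM2r ?failure_ge0 //; first exact: chance_itv.
by rewrite ler_weXn2l ?ler1n // -mulnSr leq_mul2l (card_setD_offer_on OF) ?orbT.
Qed.

End Boards.

Lemma forces_boards (b v d : nat) (K : finType) :
  exists N, forall (V I : finType) (kind : I -> K) (D : {set V}) (W0 : pred {set V})
    (B : I -> {set V}) (W : I -> pred {set V}),
    monotone W0 -> (forall i, monotone (W i)) ->
    (forall i j, i != j -> [disjoint B i & B j]) -> (forall i, [disjoint D & B i]) ->
    #|D| <= d -> (forall i, #|B i| <= v) -> (forall k, N <= #|[set i | kind i == k]|) ->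
    forces b W0 set0 D -> (forall i, forces b (W i) set0 (B i)) ->
    forces b (fun C => W0 C && [forall k, [exists (i | kind i == k), W i C]]) set0 setT.
Proof.
pose c : rat := (2 * b.+1%:R ^+ v)^-1%R.
have c01 : (0 < c <= 1)%R.
  rewrite invr_gt0 mulr_gt0 ?exprn_gt0 //= invf_le1 ?mulr_gt0 ?exprn_gt0 //.
  by rewrite -[leLHS]mulr1 ler_pM ?ler1n // exprn_ege1 // ler1n.
have [N smallN] := exists_mul_expr_lt1 (2 ^+ (b * d) * #|K|%:R)%R c01.
exists N => V I kind D W0 B W mW0 mW dB dDB Dd Bv kindN winD winB.
have [c0 c1] := andP c01; apply: (forces_boards_of_failure dB dDB mW0 mW).
  by rewrite forces_on_start.
apply: le_lt_trans smallN; rewrite setTI -mulrA.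
apply: ler_pM; rewrite ?exprn_ge0 ?failure_ge0 //; first exact: chance_itv.
  by rewrite ler_weXn2l ?ler1n // leq_mul2l Dd orbT.
apply: failure_uniform_le; rewrite ?c1 ?(ltW c0) // => i.
have /andP[_ ->] := chance_itv b B W set0 setT i.
rewrite andbT /chance forces_on_start // winB setTI.
rewrite lef_pV2 ?posrE ?mulr_gt0 ?exprn_gt0 // ler_pM2l //.
by rewrite ler_weXn2l ?ler1n.
Qed.

(** * Connected sets and forests *)

Inductive connected_set (V : finType) (e : rel V) : {set V} -> Prop :=
| connected_set1 x : connected_set e [set x]
| connected_setU1 S x y of connected_set e S & x \notin S & y \in S & e x y :
    connected_set e (x |: S).

Definition induced (V : finType) (e : rel V) (S : {set V}) : rel V :=
  [rel x y in S | e x y].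

Lemma mem_component (V : finType) (e : rel V) x : x \in component e x.
Proof. by rewrite inE. Qed.

Lemma component_closed (V : finType) (e : rel V) x y z :
  y \in component e x -> e y z -> z \in component e x.
Proof. by rewrite !inE => exy eyz; apply: connect_trans exy (connect1 eyz). Qed.

Lemma connect_hom (U V : finType) (e : rel U) (e' : rel V) (f : U -> V) (S : {set U}) :
  symmetric e' -> connected_set e S ->
  {in S &, forall x y, e x y -> e' (f x) (f y)} ->
  {in S &, forall x y, connect e' (f x) (f y)}.
Proof.
move=> /sym_connect_sym sym_e' connS; elim: connS => [x|T x y _ IH xT yT exy] hom_f.
  by move=> a c /set1P -> /set1P ->; apply: connect0.
have homT : {in T &, forall a c, e a c -> e' (f a) (f c)}.
  by move=> a c aT cT; apply: hom_f; apply: setU1r.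
have connxT c : c \in T -> connect e' (f x) (f c).
  move=> cT; apply: connect_trans (IH homT y c yT cT); apply: connect1.
  by apply: hom_f; rewrite ?setU11 ?setU1r.
move=> a c /setU1P[->|aT] /setU1P[->|cT]; first exact: connect0.
- exact: connxT.
- by rewrite sym_e'; apply: connxT.
- exact: IH.
Qed.

Section Connectivity.
Variables (V : finType) (e : rel V).
Hypothesis simple_e : simple_graph e.
Implicit Types (S T : {set V}) (x y z : V).

Let sym_e : symmetric e := simple_e.1.
Let irr_e : irreflexive e := simple_e.2.

Lemma induced_simple S : simple_graph (induced e S).
Proof.
split=> [x y|x]; rewrite /induced /=; last by rewrite irr_e andbF.
by rewrite sym_e [(x \in S) && _]andbC.
Qed.

Lemma induced_connected S :
  connected_set e S -> {in S &, forall x y, connect (induced e S) x y}.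
Proof.
move=> connS; apply: (connect_hom (f := id)) connS _; first exact: (induced_simple S).1.
by move=> x y xS yS exy; rewrite /induced /= xS yS.
Qed.

Lemma path_induced S x p : path (induced e S) x p -> path e x p /\ {subset p <= S}.
Proof.
rewrite /induced; elim: p x => // y p IH x /= /andP[/andP[/andP[_ yS] ->] /IH[-> sub_p]].
by split=> // z; rewrite inE => /predU1P[->|/sub_p].
Qed.

Lemma exists_edge_out S x y : connect e x y -> x \in S -> y \notin S ->
  exists a c, [/\ a \in S, c \notin S & e a c].
Proof.
move=> exy xS yS; have [|/existsPn closedS] :=
    boolP [exists a, exists c, [&& a \in S, c \notin S & e a c]].
  by case/existsP=> a /existsP[c /and3P[? ? ?]]; exists a, c.
have clS : closed e (mem S).
  apply: (intro_closed (sym_connect_sym sym_e)) => a c eac aS.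
  by have /existsPn/(_ c) := closedS a; rewrite aS eac andbT negbK.
by rewrite -(closed_connect clS exy) /= xS in yS.
Qed.

Lemma exists_connected_set x k : 0 < k <= #|component e x| ->
  exists S, [/\ connected_set e S, S \subset component e x & #|S| = k].
Proof.
elim: k => // -[_ _|k IH /andP[_ lt_k]].
  exists [set x]; rewrite sub1set mem_component cards1; split=> //.
  exact: connected_set1.
have [|S [connS sSx cardS]] := IH; first exact: ltnW.
have /subsetPn[z zx zS] : ~~ (component e x \subset S).
  by apply: contraL lt_k => /subset_leq_card; rewrite cardS -leqNgt.
have [y yS] : exists y, y \in S by apply/card_gt0P; rewrite cardS.
have yz : connect e y z.
  have := subsetP sSx y yS; rewrite !inE (sym_connect_sym sym_e) => /connect_trans.
  by apply; move: zx; rewrite inE.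
have [a [c [aS cS eac]]] := exists_edge_out yz yS zS.
exists (c |: S); split; last by rewrite cardsU1 cS cardS.
  by apply: connected_setU1 connS cS aS _; rewrite sym_e.
by rewrite subUset sSx sub1set andbT (component_closed (subsetP sSx a aS)).
Qed.

Lemma component_connected x : connected_set e (component e x).
Proof.
have [|S [connS sSx cardS]] := @exists_connected_set x #|component e x|.
  by rewrite leqnn andbT; apply/card_gt0P; exists x; apply: mem_component.
by have /eqP <- : S == component e x by rewrite eqEcard sSx cardS leqnn.
Qed.

Lemma component_card_gt1 x y : e x y -> 1 < #|component e x|.
Proof.
move=> exy; have xy : x != y by apply: contraTneq exy => ->; rewrite irr_e.
have <- : #|[set x; y]| = 2 by rewrite cards2 xy.
apply: subset_leq_card; apply/subsetP => z /set2P[] ->; first exact: mem_component.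
exact: component_closed (mem_component e x) exy.
Qed.

End Connectivity.

Definition degree (V : finType) (e : rel V) (S : {set V}) (x : V) : nat :=
  #|[set y in S | e x y]|.

Definition degree_sum (V : finType) (e : rel V) (S : {set V}) : nat :=
  \sum_(x in S) degree e S x.

Definition nedges_in (V : finType) (e : rel V) (S : {set V}) : nat :=
  degree_sum e S %/ 2.

Section Degrees.
Variables (V : finType) (e : rel V).
Hypothesis simple_e : simple_graph e.
Implicit Types (S T : {set V}) (x y z : V).

Let sym_e : symmetric e := simple_e.1.
Let irr_e : irreflexive e := simple_e.2.

Lemma degreeE S x : degree e S x = \sum_(y in S) e x y.
Proof. exact: card_set_sum. Qed.

Lemma degree_sumE S : degree_sum e S = \sum_(x in S) \sum_(y in S) e x y.
Proof. by apply: eq_bigr => x _; apply: degreeE. Qed.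

Lemma degree_sum0 : degree_sum e set0 = 0.
Proof. exact: big_set0. Qed.

Lemma degreeS S T x : S \subset T -> degree e S x <= degree e T x.
Proof. by move=> sST; rewrite /degree !setIdE subset_leq_card ?setSI. Qed.

Lemma nedges_inS S T : S \subset T -> nedges_in e S <= nedges_in e T.
Proof.
move=> sST; apply: leq_div2r; rewrite /degree_sum [leqRHS](big_setID S) /= (setIidPr sST).
by apply: leq_trans (leq_addr _ _); apply: leq_sum => x _; apply: degreeS.
Qed.

Lemma degree_sumU1 S x :
  x \notin S -> degree_sum e (x |: S) = degree_sum e S + 2 * degree e S x.
Proof.
move=> xS; rewrite !degree_sumE big_setU1 //= big_setU1 //= irr_e add0n.
rewrite [X in _ + X = _](eq_bigr (fun a => e x a + \sum_(c in S) e a c)) => [|a aS].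
  by rewrite big_split /= -degreeE mul2n -addnn; lia.
by rewrite big_setU1 //= sym_e.
Qed.

Lemma degree_sum_connected S : connected_set e S -> 2 * #|S| <= degree_sum e S + 2.
Proof.
elim=> [x|T x y _ IH xT yT exy]; first by rewrite cards1 leq_addl.
have : 0 < degree e T x by apply/card_gt0P; exists y; rewrite inE yT.
by rewrite degree_sumU1 // cardsU1 xT; lia.
Qed.

Lemma cycle_two_nbrs (s : seq V) x : uniq s -> 3 <= size s -> cycle e s -> x \in s ->
  exists y z, [/\ y \in s, z \in s, y != z, e x y & e x z].
Proof.
move=> uniq_s size_s cycle_s /rot_to[i s' rot_s].
have mem_s y : (y \in s) = (y \in x :: s') by rewrite -rot_s mem_rot.
move: uniq_s size_s cycle_s; rewrite -(rot_cycle i) -(rot_uniq i) -(size_rot i) rot_s.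
case: s' {rot_s} mem_s => [|y [|z s']] // mem_s /and4P[_ yzs' _ _] _.
rewrite /= rcons_path => /and3P[exy _ /andP[_ ezx]].
exists y, (last z s'); split=> //.
- by rewrite mem_s !inE eqxx orbT.
- by rewrite mem_s inE [_ \in y :: _]inE mem_last !orbT.
- by apply: contraNneq yzs' => ->; apply: mem_last.
- by rewrite sym_e.
Qed.

Lemma degree_sum_cycle (s : seq V) : uniq s -> 3 <= size s -> cycle e s ->
  2 * size s <= degree_sum e [set x in s].
Proof.
move=> uniq_s size_s cycle_s; rewrite -(card_uniqP uniq_s) -cardsE mulnC.
rewrite -sum_nat_const; apply: leq_sum => x; rewrite inE => xs.
have [y [z [ys zs yz exy exz]]] := cycle_two_nbrs uniq_s size_s cycle_s xs.
have <- : #|[set y; z]| = 2 by rewrite cards2 yz.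
by apply: subset_leq_card; apply/subsetP => w /set2P[] ->; rewrite !inE ?ys ?zs.
Qed.

Lemma forest_of_degree_sum :
  (forall S, S != set0 -> degree_sum e S < 2 * #|S|) -> is_forest e.
Proof.
move=> sparse; split=> // -[s [uniq_s size_s cycle_s]].
have s0 : [set x in s] != set0.
  by rewrite -card_gt0 cardsE (card_uniqP uniq_s); apply: leq_trans size_s.
have := sparse _ s0; rewrite cardsE (card_uniqP uniq_s) ltnNge.
by rewrite degree_sum_cycle.
Qed.

Lemma degree_sum_oriented (rank : V -> nat) S : injective rank ->
  degree_sum e S =
    2 * #|[set d in setX S S | (rank d.1 < rank d.2) && e d.1 d.2]|.
Proof.
move=> rank_inj; rewrite degree_sumE.
pose up x y := (rank x < rank y) && e x y.
have -> : #|[set d in setX S S | up d.1 d.2]| = \sum_(x in S) \sum_(y in S) up x y.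
  by rewrite pair_big card_set_sum; apply: eq_bigl => d; rewrite !inE.
rewrite mul2n -addnn [X in _ + X]exchange_big -big_split; apply: eq_bigr => x _ /=.
rewrite -big_split; apply: eq_bigr => y _; rewrite /up (sym_e y x).
by case: ltngtP => //= [|/rank_inj ->]; rewrite ?addn0 // irr_e.
Qed.

End Degrees.

Section Forests.
Variables (V : finType) (e : rel V).
Implicit Types (S T : {set V}) (x y z : V).

Lemma forest_unique_nbr S x y z : is_forest e -> connected_set e S ->
  x \notin S -> y \in S -> z \in S -> e x y -> e x z -> y = z.
Proof.
move=> [simple_e acyclic_e] connS xS yS zS exy exz; have [sym_e _] := simple_e.
apply: contraPeq acyclic_e => yz acyclic_e; apply: acyclic_e.
have /connectP[p0 p0_path z_last] := induced_connected simple_e connS yS zS.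
case/shortenP: p0_path z_last => p p_path uniq_p _ z_last.
have [path_p sub_p] := path_induced p_path.
exists (x :: y :: p); split.
- rewrite cons_uniq uniq_p andbT; apply: contraNN xS => /predU1P[->//|].
  exact: sub_p.
- by case: p z_last {p_path uniq_p path_p sub_p} yz => //= ->; rewrite eqxx.
- by rewrite /= exy rcons_path path_p -z_last sym_e.
Qed.

Lemma connected_set_leaf T : is_forest e -> connected_set e T ->
  exists2 x, x \in T & degree e T x <= 1.
Proof.
move=> forest_e; have [[_ irr_e] _] := forest_e; case=> [x|T' x y connT' xT' _ _].
  by exists x; rewrite ?set11 // -(cards1 x) /degree setIdE subset_leq_card ?subsetIl.
exists x; first exact: setU11.
apply/card_le1_eqP => a c; rewrite !inE.
case/andP=> /predU1P[->|aT']; first by rewrite irr_e.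
move=> exa /andP[/predU1P[->|cT']]; first by rewrite irr_e.
by move=> exc; apply: forest_unique_nbr connT' xT' cT' aT' exc exa.
Qed.

Lemma connected_set_subrel (e' : rel V) S :
  subrel e' e -> connected_set e' S -> connected_set e S.
Proof.
move=> sub_e; elim=> [x|T x y _ connT xT yT /sub_e exy]; first exact: connected_set1.
exact: connected_setU1 exy.
Qed.

Lemma component_induced S x : x \in S -> component (induced e S) x \subset S.
Proof.
move=> xS; apply/subsetP => y; rewrite inE => /connectP[p p_path ->].
have [_ sub_p] := path_induced p_path.
by have := mem_last x p; rewrite inE => /predU1P[->|/sub_p].
Qed.

Lemma forest_leaf S : is_forest e -> S != set0 -> exists2 x, x \in S & degree e S x <= 1.
Proof.
move=> forest_e /set0Pn[r rS]; set T := component (induced e S) r.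
have sTS : T \subset S := component_induced rS.
have connT : connected_set e T.
  apply: connected_set_subrel (component_connected (induced_simple forest_e.1 S) r).
  by move=> x y /andP[].
have [x xT degTx] := connected_set_leaf forest_e connT.
have xS := subsetP sTS x xT; exists x => //; apply: leq_trans degTx.
apply: subset_leq_card; apply/subsetP => y; rewrite 2!inE => /andP[yS exy].
by rewrite exy andbT; apply: component_closed xT _; rewrite /induced /= xS yS.
Qed.

Lemma degree_sum_forest S : is_forest e -> S != set0 -> degree_sum e S + 2 <= 2 * #|S|.
Proof.
move=> forest_e; have [n] := ubnP #|S|; elim: n S => // n IH S Sn S0.
have [x xS degSx] := forest_leaf forest_e S0.
have degx : degree e (S :\ x) x <= 1.
  exact: leq_trans (degreeS e x (subsetDl _ _)) degSx.
rewrite -{1}(setD1K xS) (degree_sumU1 forest_e.1) ?setD11 //.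
move: Sn; rewrite (cardsD1 x S) xS /= => Sn; have [->|Sx0] := eqVneq (S :\ x) set0.
  by rewrite degree_sum0 /degree setIdE set0I !cards0.
by have := IH _ Sn Sx0; lia.
Qed.

Lemma tree_connected : is_tree e -> connected_set e setT.
Proof.
move=> [[simple_e _] [/card_gt0P[x _] conn_e]].
have <- : component e x = setT by apply/setP => y; rewrite !inE conn_e.
exact: component_connected.
Qed.

Lemma nedgesE : nedges e = nedges_in e setT.
Proof.
congr (_ %/ 2); rewrite degree_sumE pair_big -sum1_card big_mkcond [RHS]big_mkcond /=.
by apply: eq_bigr => d _; rewrite !inE /=; case: (e _ _).
Qed.

Lemma nedges_tree : is_tree e -> nedges e = #|V|.-1.
Proof.
move=> tree_e; have [[simple_e _] [V0 _]] := tree_e.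
have := degree_sum_connected simple_e (tree_connected tree_e).
have := degree_sum_forest tree_e.1 (S := setT); rewrite -card_gt0 cardsT => /(_ V0).
rewrite nedgesE /nedges_in; lia.
Qed.

End Forests.

Lemma degree_sum_imset (U V : finType) (f : U -> V) (e : rel V) (S : {set U}) :
  injective f -> degree_sum e (f @: S) = degree_sum (relpre f e) S.
Proof.
move=> f_inj; have inj_in : {in S &, injective f} by move=> ? ? _ _; apply: f_inj.
by rewrite !degree_sumE big_imset //; apply: eq_bigr => x _; rewrite big_imset.
Qed.

Section DisjointUnion.
Variables (K : finType) (U : K -> finType) (e : forall k, rel (U k)).
Arguments e : clear implicits.

Definition disjoint_union : rel {k : K & U k} :=
  fun a c => (tag a == tag c) && e (tag a) (tagged a) (tagged_as a c).

Lemma disjoint_unionE k (a c : U k) :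
  disjoint_union (existT U k a) (existT U k c) = e k a c.
Proof. by rewrite /disjoint_union eqxx tagged_asE. Qed.

Lemma disjoint_union_simple :
  (forall k, simple_graph (e k)) -> simple_graph disjoint_union.
Proof.
move=> simple_e; split=> [[k a] [l c]|[k a]]; last first.
  by rewrite disjoint_unionE; case: (simple_e k).
have [kl|kl] := eqVneq k l; last first.
  by rewrite /disjoint_union /= (negPf kl) eq_sym (negPf kl).
by case: l / kl c => c; rewrite !disjoint_unionE; case: (simple_e k).
Qed.

Implicit Types (S : {set {k : K & U k}}).

Lemma sum_disjoint_union S (F : {k : K & U k} -> nat) :
  \sum_(a in S) F a = \sum_k \sum_(a in existT U k @^-1: S) F (existT U k a).
Proof.
rewrite sig_big_dep /=; apply: eq_big => [[k a]|[k a] _] //=.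
by rewrite inE.
Qed.

Lemma degree_sum_disjoint_union S :
  degree_sum disjoint_union S = \sum_k degree_sum (e k) (existT U k @^-1: S).
Proof.
rewrite degree_sumE sum_disjoint_union; apply: eq_bigr => k _.
rewrite degree_sumE; apply: eq_bigr => a _; rewrite sum_disjoint_union.
rewrite (bigD1 k) //= [X in _ + X]big1 => [|l lk].
  by rewrite addn0; apply: eq_bigr => c _; rewrite disjoint_unionE.
by rewrite big1 // => c _; rewrite /disjoint_union /= eq_sym (negPf lk).
Qed.

Lemma disjoint_union_density v S : (forall k, is_forest (e k)) ->
  (forall k, #|U k| <= v) -> v * degree_sum disjoint_union S <= 2 * v.-1 * #|S|.
Proof.
move=> forest_e Uv; rewrite degree_sum_disjoint_union -sum1_card sum_disjoint_union.
rewrite !big_distrr /=; apply: leq_sum => k _; rewrite sum1_card.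
set X := _ @^-1: S; have Xv : #|X| <= v := leq_trans (max_card _) (Uv k).
have [->|X0] := eqVneq X set0; first by rewrite degree_sum0 muln0.
by have := degree_sum_forest (forest_e k) X0; nia.
Qed.

End DisjointUnion.

(** * Copies of a graph *)

Section Copies.
Variables (VH : finType) (eH : rel VH).
Implicit Types (A : {set VH}).

Definition is_copy A (VG : finType) (eG : rel VG) (C : {set VG}) (f : VH -> VG) : Prop :=
  [/\ {in A, forall x, f x \in C}, {in A &, injective f} &
      {in A &, forall x y, eH x y -> eG (f x) (f y)}].

Lemma has_copyP A (VG : finType) (eG : rel VG) (C : {set VG}) :
  reflect (exists f, is_copy A eG C f) (has_copy eH A eG C).
Proof.
apply: (iffP existsP) => [[f /andP[/forall_inP fC /forall_inP fA]]|[f [fC f_inj f_hom]]].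
  exists f; split=> // x y xA yA; have /forall_inP/(_ y yA)/andP[] := fA x xA.
    by move=> /implyP f_inj _ fxy; apply/eqP/f_inj; rewrite fxy.
  by move=> _ /implyP.
exists (finfun f); apply/andP; split; first by apply/forall_inP => x /fC; rewrite ffunE.
apply/forall_inP => x xA; apply/forall_inP => y yA; rewrite !ffunE.
apply/andP; split; apply/implyP; last exact: f_hom.
by move=> /eqP/f_inj ->.
Qed.

Lemma has_copy_monotone A (VG : finType) (eG : rel VG) : monotone (has_copy eH A eG).
Proof.
move=> C C' sCC' /has_copyP[f [fC f_inj f_hom]]; apply/has_copyP; exists f; split=> //.
by move=> x /fC /(subsetP sCC').
Qed.

Lemma has_copy_sub A A' (VG : finType) (eG : rel VG) (C : {set VG}) :
  A' \subset A -> has_copy eH A eG C -> has_copy eH A' eG C.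
Proof.
move=> /subsetP sA'A /has_copyP[f [fC f_inj f_hom]]; apply/has_copyP; exists f.
split=> [x /sA'A /fC //|x y /sA'A xA /sA'A yA|x y /sA'A xA /sA'A yA].
  exact: f_inj.
exact: f_hom.
Qed.

Lemma has_copy_card A (VG : finType) (eG : rel VG) (C : {set VG}) :
  has_copy eH A eG C -> #|A| <= #|C|.
Proof.
move=> /has_copyP[f [fC f_inj _]]; rewrite -(card_in_imset f_inj).
by apply: subset_leq_card; apply/subsetP => _ /imsetP[x /fC ? ->].
Qed.

Lemma has_copy_preimset A (U V : finType) (eU : rel U) (eV : rel V) (f : U -> V)
    (C : {set V}) :
  injective f -> (forall x y, eU x y -> eV (f x) (f y)) ->
  has_copy eH A eU (f @^-1: C) -> has_copy eH A eV C.
Proof.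
move=> f_inj f_hom /has_copyP[g [gC g_inj g_hom]]; apply/has_copyP; exists (f \o g).
split=> [x /gC|x y xA yA /f_inj/g_inj->//|x y xA yA /(g_hom x y xA yA)/f_hom//].
by rewrite inE.
Qed.

(* If A and U are empty but VH is not, then [has_copy] is false for want of a function
   from VH to U. *)
Lemma has_copy_relpre A (U V : finType) (eV : rel V) (f : U -> V) (C : {set U}) :
  injective f -> A != set0 -> has_copy eH A eV (f @: C) -> has_copy eH A (relpre f eV) C.
Proof.
move=> f_inj /set0Pn[x0 x0A] /has_copyP[g [gC g_inj g_hom]].
have /imsetP[u0 _ _] := gC x0 x0A.
pose h x := odflt u0 [pick u | f u == g x].
have hE x : x \in A -> f (h x) = g x.
  move=> /gC/imsetP[u _ gxu]; rewrite /h; case: pickP => [w /eqP //|/(_ u)].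
  by rewrite gxu eqxx.
apply/has_copyP; exists h; split=> [x xA|x y xA yA hxy|x y xA yA exy] /=.
- by rewrite -(mem_imset _ _ f_inj) hE // gC.
- by apply: g_inj; rewrite // -!hE // hxy.
- by rewrite !hE // g_hom.
Qed.

Lemma has_copyU1 A x (VG : finType) (eG : rel VG) (C : {set VG}) (f : VH -> VG) z :
  simple_graph eH -> symmetric eG -> x \notin A -> is_copy A eG C f ->
  z \in C -> z \notin f @: A -> {in A, forall y, eH x y -> eG z (f y)} ->
  has_copy eH (x |: A) eG C.
Proof.
move=> [sym_eH irr_eH] sym_eG xA [fC f_inj f_hom] zC zf z_hom.
pose g y := if y == x then z else f y.
have gx : g x = z by rewrite /g eqxx.
have gA y : y \in A -> g y = f y.
  by move=> yA; rewrite /g; case: eqVneq xA => // <-; rewrite yA.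
have zg y : y \in A -> z <> f y by move=> yA zfy; rewrite zfy imset_f in zf.
apply/has_copyP; exists g; split.
- by move=> y /setU1P[->|yA]; rewrite ?gx ?gA ?fC.
- move=> y w /setU1P[->|yA] /setU1P[->|wA] //; rewrite ?gx ?gA //.
  + by move/(zg w wA).
  + by move/esym/(zg y yA).
  + exact: f_inj.
- move=> y w /setU1P[->|yA] /setU1P[->|wA]; rewrite ?gx ?gA ?irr_eH //.
  + exact: z_hom.
  + by rewrite sym_eH sym_eG; apply: z_hom.
  + exact: f_hom.
Qed.

Lemma has_copy_glue (VG : finType) (eG : rel VG) (C : {set VG}) (P : VH -> {set VG}) :
  symmetric eH -> (forall x y, x != y -> [disjoint P x & P y]) ->
  (forall x, has_copy eH (component eH x) eG (C :&: P x)) -> has_copy eH setT eG C.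
Proof.
move=> sym_eH disjP copies; have sym_conn := sym_connect_sym sym_eH.
have /fin_all_exists[f f_copy] x := has_copyP _ _ _ (copies x).
have rootP x : x \in component eH (root eH x) by rewrite inE sym_conn connect_root.
have fCP x : f (root eH x) x \in C :&: P (root eH x).
  by have [fC _ _] := f_copy (root eH x); apply: fC.
apply/has_copyP; exists (fun x => f (root eH x) x); split=> [x _|x y _ _ fxy|x y _ _ exy].
- by have /setIP[] := fCP x.
- have [rxy|rxy] := eqVneq (root eH x) (root eH y).
    have [_ f_inj _] := f_copy (root eH y).
    by apply: f_inj; rewrite // -?rxy // fxy rxy.
  have /setIP[_ fyP] := fCP y; have /setIP[_] := fCP x.
  by rewrite fxy (disjointFl (disjP _ _ rxy)).
- have rxy : root eH x = root eH y by apply/eqP; rewrite root_connect // connect1.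
  by have [_ _ f_hom] := f_copy (root eH y); rewrite rxy; apply: f_hom; rewrite // -rxy.
Qed.

End Copies.

Section GameOnGraph.
Variables (b : nat) (VH : finType) (eH : rel VH) (A : {set VH}).

Lemma client_winsE (V : finType) (e : rel V) :
  client_wins b eH A e = forces b (has_copy eH A e) set0 setT.
Proof.
have winsE n C F :
    cw_client_wins b eH A e n C F = forces_within b (has_copy eH A e) n C F.
  elim: n C F => //= n IH C F; case: ifP => // _; apply: eq_forallb => O.
  by rewrite inE; congr (_ ==> _); apply: eq_existsb => x; rewrite IH.
by rewrite /client_wins /forces winsE cardsT.
Qed.

Lemma client_wins_card (V : finType) (e : rel V) : client_wins b eH A e -> #|A| <= #|V|.
Proof.
rewrite client_winsE => /forces_sat[C /has_copy_card leAC].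
exact: leq_trans leAC (max_card _).
Qed.

Variables (U V : finType) (eU : rel U) (eV : rel V) (f : U -> V).
Hypothesis f_inj : injective f.

Lemma client_wins_on_image :
  client_wins b eH A eU ->
  forces b (fun C => has_copy eH A eU (f @^-1: C)) set0 (f @: setT).
Proof.
rewrite client_winsE -(imset0 f) forces_imset //; apply: forces_sub => C.
by rewrite preimset_imsetK.
Qed.

Lemma client_wins_hom : (forall x y, eU x y -> eV (f x) (f y)) ->
  client_wins b eH A eU -> client_wins b eH A eV.
Proof.
move=> f_hom /client_wins_on_image winU; rewrite client_winsE.
apply: forces_subset (@has_copy_monotone _ _ _ _ _) (subsetT (f @: setT)) _.
by apply: forces_sub winU => C; apply: has_copy_preimset.
Qed.

Lemma client_wins_relpre : A != set0 ->
  forces b (has_copy eH A eV) set0 (f @: setT) -> client_wins b eH A (relpre f eV).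
Proof.
rewrite client_winsE -{1}(imset0 f) forces_imset // => A0; apply: forces_sub => C.
exact: has_copy_relpre.
Qed.

End GameOnGraph.

(** * Winning trees *)

Section WithLeaves.
Variables (V : finType) (e : rel V) (N : nat).

Definition with_leaves : rel (V + V * 'I_N) :=
  fun u w => match u, w with
             | inl x, inl y => e x y
             | inl x, inr l | inr l, inl x => x == l.1
             | inr _, inr _ => false
             end.

Lemma with_leaves_simple : simple_graph e -> simple_graph with_leaves.
Proof. by move=> [sym_e irr_e]; split=> [[x|l] [y|m]|[x|l]] /=. Qed.

Lemma with_leaves_forest : is_forest e -> is_forest with_leaves.
Proof.
move=> [simple_e acyclic_e]; have simple_w := with_leaves_simple simple_e.
split=> // -[s [uniq_s size_s cycle_s]]; apply: acyclic_e.
have s_inl : {subset s <= codom inl}.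
  move=> [x|l] ls; first exact: codom_f.
  have [y [z [_ _]]] := cycle_two_nbrs simple_w uniq_s size_s cycle_s ls.
  by case: y z => [y|?] [z|?] //= yz /eqP yl /eqP zl; rewrite yl zl eqxx in yz.
exists (preim_seq inl s); move: uniq_s size_s cycle_s.
by rewrite -{1 2 3}(map_preim s_inl) size_map map_inj_uniq ?cycle_map // => ? ? [].
Qed.

Lemma with_leaves_tree : is_tree e -> is_tree with_leaves.
Proof.
move=> tree_e; have [forest_e [V0 _]] := tree_e.
have forest_w := with_leaves_forest forest_e; have [[sym_w _] _] := forest_w.
split=> //; split; first by rewrite card_sum ltn_addr.
have conn_inl x y : connect with_leaves (inl x) (inl y).
  by apply: (connect_hom (f := inl) sym_w (tree_connected tree_e)); rewrite ?inE.
have conn_base u : exists x, connect with_leaves u (inl x).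
  by case: u => [x|l]; [exists x | exists l.1; apply: connect1 => /=].
move=> u w; have [x ux] := conn_base u; have [y wy] := conn_base w.
apply: connect_trans (connect_trans ux (conn_inl x y)) _.
by rewrite (sym_connect_sym sym_w).
Qed.

End WithLeaves.
Arguments with_leaves {V} e N.

Lemma has_copy_with_leaves (VH : finType) (eH : rel VH) (S : {set VH}) x y
    (V : finType) (e : rel V) (N : nat) (C : {set V + V * 'I_N}) :
  is_forest eH -> connected_set eH S -> x \notin S -> y \in S -> eH x y ->
  simple_graph e -> has_copy eH S e (inl @^-1: C) ->
  (forall a, exists i, inr (a, i) \in C) -> has_copy eH (x |: S) (with_leaves e N) C.
Proof.
move=> forestH connS xS yS exy simple_e /has_copyP[f [fC f_inj f_hom]] leaves.
have [i iC] := leaves (f y); have [sym_w _] := with_leaves_simple N simple_e.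
apply: (has_copyU1 (f := inl \o f) (z := inr (f y, i)) forestH.1 sym_w) => //=.
- split=> // [w /fC|w w' wS w'S [] /f_inj]; [by rewrite inE | exact].
- by apply/imsetP => -[].
- move=> w wS exw.
  by rewrite (forest_unique_nbr forestH connS xS wS yS exw exy).
Qed.

Lemma client_wins_with_leaves (b : nat) (VH : finType) (eH : rel VH) (S : {set VH}) x y
    (V : finType) (e : rel V) :
  is_forest eH -> connected_set eH S -> x \notin S -> y \in S -> eH x y ->
  simple_graph e -> client_wins b eH S e ->
  exists N, client_wins b eH (x |: S) (with_leaves e N).
Proof.
move=> forestH connS xS yS exy simple_e win.
have [N forcesN] := forces_boards b 1 #|V| V; exists N.
have inl_inj : injective (@inl V (V * 'I_N)) by move=> ? ? [].
rewrite client_winsE.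
apply: (forces_sub _ (forcesN _ (V * 'I_N)%type fst (inl @: setT)
  (fun C => has_copy eH S e (inl @^-1: C)) (fun l => [set inr l])
  (fun l C => inr l \in C) _ _ _ _ _ _ _ _ _)).
- move=> C /andP[copyS /forallP leaves].
  apply: has_copy_with_leaves forestH connS xS yS exy simple_e copyS _ => a.
  by have /exists_inP[[a' i] /eqP <- iC] := leaves a; exists i.
- by move=> C C' sCC'; apply: has_copy_monotone; apply: preimsetS.
- by move=> l C C' /subsetP sCC'; apply: sCC'.
- by move=> l m lm; rewrite disjoints1 inE; apply: contraNneq lm => -[->].
- by move=> l; rewrite disjoint_sym disjoints1; apply/imsetP => -[].
- by rewrite card_imset // cardsT.
- by move=> l; rewrite cards1.
- by move=> a; rewrite card_fst_fiber card_ord.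
- exact: client_wins_on_image.
- by move=> l; apply: forces_mem.
Qed.

Lemma is_tree_unit : is_tree (fun _ _ : unit => false).
Proof.
split; last by split; [rewrite card_unit | move=> [] []].
by split=> // -[[|u [|w s]] [_ size_s //= /andP[]]].
Qed.

Lemma client_wins_unit (b : nat) (VH : finType) (eH : rel VH) x :
  irreflexive eH -> client_wins b eH [set x] (fun _ _ : unit => false).
Proof.
move=> irr_eH; rewrite client_winsE -(_ : [set tt] = setT).
  apply: forces_sub (forces_mem b tt) => C ttC; apply/has_copyP; exists (fun=> tt).
  by split=> // z w /set1P -> /set1P ->; rewrite ?irr_eH.
by apply/setP => -[]; rewrite !inE.
Qed.

Lemma exists_winning_tree (b : nat) (VH : finType) (eH : rel VH) (A : {set VH}) :
  is_forest eH -> connected_set eH A ->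
  exists (VT : finType) (eT : rel VT), is_tree eT /\ client_wins b eH A eT.
Proof.
move=> forestH; elim=> [x|S x y connS [VT [eT [treeT winT]]] xS yS exy].
  exists unit, (fun _ _ => false); split; first exact: is_tree_unit.
  exact: (client_wins_unit b x forestH.1.2).
have [N winN] := client_wins_with_leaves forestH connS xS yS exy treeT.1.1 winT.
by exists (VT + VT * 'I_N)%type, (with_leaves eT N); split; first exact: with_leaves_tree.
Qed.

(* There are boards for every vertex x of H, to be won for its component; those of the
   representatives [root eH x] make up the copy of H. *)
Lemma client_wins_disjoint_union (b : nat) (VH : finType) (eH : rel VH)
    (VT : VH -> finType) (eT : forall x, rel (VT x)) : simple_graph eH ->
  (forall x, client_wins b eH (component eH x) (@eT x)) ->
  exists N, client_wins b eH setT (disjoint_union (fun i : VH * 'I_N => @eT i.1)).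
Proof.
move=> [sym_eH _] winT.
have [N forcesN] := forces_boards b (\max_x #|VT x|) 0 VH; exists N.
pose U (i : VH * 'I_N) := VT i.1; pose board (i : VH * 'I_N) := existT U i @: setT.
have board_inj (i : VH * 'I_N) : injective (existT U i) := @existT_inj _ U i.
rewrite client_winsE.
apply: (forces_sub _ (forcesN _ (VH * 'I_N)%type fst set0 predT board
  (fun i C => has_copy eH (component eH i.1) (@eT i.1) (existT U i @^-1: C))
  _ _ _ _ _ _ _ _ _)) => //.
- move=> C /forallP won_boards.
  have /fin_all_exists[j wonj] x : exists j : 'I_N,
      has_copy eH (component eH x) (@eT x) (existT U (x, j) @^-1: C).
    by have /exists_inP[[x' j] /eqP <- wonj] := won_boards x; exists j.
  apply: (has_copy_glue (P := fun x => board (x, j x)) sym_eH) => [x y xy|x].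
    by apply: disjoint_imset_existT; apply: contraNneq xy => -[->].
  apply: (has_copy_preimset (eU := @eT x) (board_inj (x, j x))) => [a c eac|].
    by rewrite disjoint_unionE.
  apply: has_copy_monotone (wonj x); apply/subsetP => a; rewrite !inE => ->.
  exact: imset_f.
- by move=> i C C' sCC'; apply: has_copy_monotone; apply: preimsetS.
- by move=> i j; apply: disjoint_imset_existT.
- by move=> i; apply/pred0P => z; rewrite !inE.
- by rewrite cards0.
- by move=> i; rewrite card_imset // cardsT leq_bigmax.
- by move=> x; rewrite card_fst_fiber card_ord.
- by rewrite forces0.
- by move=> i; apply: client_wins_on_image (board_inj i) (winT i.1).
Qed.

Lemma component_tree (V : finType) (e : rel V) y : simple_graph e ->
  (forall S : {set V}, S \subset component e y -> S != set0 ->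
     degree_sum e S < 2 * #|S|) ->
  is_tree (relpre val e : rel {z | z \in component e y}).
Proof.
move=> simple_e sparse; have [sym_e irr_e] := simple_e.
have yP := mem_component e y.
set eU := relpre val e; have simple_eU : simple_graph eU.
  by split=> *; rewrite /eU /=; [apply: sym_e | apply: irr_e].
split.
  apply: forest_of_degree_sum simple_eU _ => S S0.
  rewrite -(degree_sum_imset e S val_inj) -(card_imset S val_inj).
  apply: sparse; last by rewrite imset_eq0.
  by apply/subsetP => _ /imsetP[z _ ->]; apply: (valP z).
split; first by apply/card_gt0P; exists (Sub y yP).
pose to_comp := insubd (Sub y yP : {z | z \in component e y}).
move=> u w; rewrite -[u](valKd (Sub y yP)) -[w](valKd (Sub y yP)) -/to_comp.
apply: (connect_hom simple_eU.1 (component_connected simple_e y)); try exact: valP.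
by move=> a c ay cy eac; rewrite /eU /= !insubdK.
Qed.

Lemma copy_in_component (VH : finType) (eH : rel VH) x (V : finType) (e : rel V)
    (C : {set V}) : simple_graph eH -> symmetric e ->
  has_copy eH (component eH x) e C ->
  exists y, has_copy eH (component eH x) e (C :&: component e y).
Proof.
move=> simple_eH sym_e /has_copyP[f [fC f_inj f_hom]]; exists (f x).
apply/has_copyP; exists f; split=> // z zx; rewrite inE fC // inE.
apply: (connect_hom sym_e (component_connected simple_eH x) f_hom) zx.
by rewrite inE.
Qed.

Lemma component_root (V : finType) (e : rel V) y : symmetric e ->
  component e y = [set z | root e z == root e y].
Proof.
move=> /sym_connect_sym sym_conn; apply/setP => z.
by rewrite !inE sym_conn root_connect.
Qed.

Definition winning_trees_geq (b : nat) (VH : finType) (eH : rel VH) (A : {set VH})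
    (v : nat) : Prop :=
  forall (VT : finType) (eT : rel VT), is_tree eT -> client_wins b eH A eT -> v <= #|VT|.

(* Such a host has no cycle on at most v vertices and no connected set of v vertices:
   its components are trees with fewer than v vertices. *)
Lemma not_client_wins_sparse (b : nat) (VH : finType) (eH : rel VH) x (v : nat)
    (V : finType) (e : rel V) : simple_graph eH ->
  winning_trees_geq b eH (component eH x) v -> 0 < v -> simple_graph e ->
  (forall S : {set V}, 0 < #|S| <= v -> degree_sum e S < 2 * minn #|S| v.-1) ->
  ~~ client_wins b eH setT e.
Proof.
move=> simple_eH min_v v0 simple_e sparse; have [sym_e _] := simple_e.
have local_copy C : has_copy eH (component eH x) e C ->
    exists y, has_copy eH (component eH x) e (C :&: [set z | root e z == root e y]).
  case/(copy_in_component simple_eH sym_e) => y.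
  by rewrite (component_root y sym_e); exists y.
apply/negP; rewrite client_winsE => win.
have /(forces_class local_copy)[y] : forces b (has_copy eH (component eH x) e) set0 setT.
  by apply: forces_sub win => C; apply/has_copy_sub/subsetT.
rewrite -(component_root y sym_e) forces_on_start // => winy.
have lt_v : #|component e y| < v.
  rewrite ltnNge; apply/negP => le_v.
  have [|S [connS _ cardS]] := @exists_connected_set _ _ simple_e y v.
    by rewrite v0.
  have := degree_sum_connected simple_e connS.
  by have := sparse S; rewrite cardS v0 leqnn => /(_ isT); lia.
suff : v <= #|component e y| by rewrite leqNgt lt_v.
rewrite -card_sig; apply: (min_v _ (relpre val e)).
  apply: component_tree simple_e _ => S /subset_leq_card leS; rewrite -card_gt0 => S0.
  by have := sparse S; rewrite S0 (leq_trans leS (ltnW lt_v)) => /(_ isT); lia.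
apply: (client_wins_relpre val_inj).
  by apply/set0Pn; exists x; apply: mem_component.
by rewrite imset_val_setT.
Qed.

(** * Bernoulli random sets *)

Section Bernoulli.
Local Open Scope ring_scope.
Variables (R : realFieldType) (T : finType) (p : R).
Implicit Types (S E : {set T}) (Q : pred {set T}) (X : {set T} -> R).

Definition bernoulli E : R := p ^+ #|E| * (1 - p) ^+ (#|T| - #|E|).

Definition Pr Q : R := \sum_(E | Q E) bernoulli E.

Definition Ex X : R := \sum_E bernoulli E * X E.

Lemma bernoulliE E : bernoulli E = \prod_t (if t \in E then p else 1 - p).
Proof.
rewrite (bigID (mem E)) /= (eq_bigr (fun=> p)) => [|t -> //].
rewrite prodr_const; congr (_ * _).
rewrite (eq_bigr (fun=> 1 - p)) => [|t /negPf -> //].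
rewrite (eq_bigl (mem (~: E))) => [|t]; last by rewrite !inE.
by rewrite prodr_const [in RHS]cardsCs setCK.
Qed.

Lemma Pr_superset S : Pr (fun E => S \subset E) = p ^+ #|S|.
Proof.
have : \prod_t (p + (if t \in S then 0 else 1 - p)) = \sum_(E in {set T})
    \prod_t (if t \in E then p else if t \in S then 0 else 1 - p).
  exact: bigA_distr.
rewrite (eq_bigr (fun t => if t \in S then p else 1)) => [|t _]; last first.
  by case: ifP => _; rewrite ?addr0 // addrC subrK.
rewrite -big_mkcond prodr_const => ->.
rewrite [RHS](bigID (fun E : {set T} => S \subset E)) /= [X in _ = _ + X]big1 ?addr0.
  apply: eq_bigr => E sSE; rewrite bernoulliE; apply: eq_bigr => t _.
  case: ifPn => // tE; case: ifPn => // tS.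
  by rewrite (subsetP sSE) in tE.
by move=> E /subsetPn[t tS tE]; rewrite (bigD1 t) //= (negPf tE) tS mul0r.
Qed.

Lemma sum_bernoulli : \sum_E bernoulli E = 1.
Proof.
rewrite -[RHS](expr0 p) -(cards0 T) -Pr_superset.
by apply: eq_bigl => E; rewrite sub0set.
Qed.

Lemma Pr_compl Q : Pr Q = 1 - Pr (predC Q).
Proof. by rewrite -sum_bernoulli (bigID Q) /= addrK. Qed.

Lemma Ex_superset S : Ex (fun E => (S \subset E)%:R) = p ^+ #|S|.
Proof.
rewrite -Pr_superset /Pr big_mkcond; apply: eq_bigr => E _.
by case: ifP; rewrite ?mulr1 ?mulr0.
Qed.

Lemma Ex_sum (I : finType) (X : I -> {set T} -> R) :
  Ex (fun E => \sum_i X i E) = \sum_i Ex (X i).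
Proof.
rewrite /Ex exchange_big; apply: eq_bigr => E _.
by rewrite mulr_sumr.
Qed.

Section Counting.
Variables (I : finType) (S : I -> {set T}).

Definition nb_contained E : R := \sum_i (S i \subset E)%:R.

Lemma Ex_nb_contained : Ex nb_contained = \sum_i p ^+ #|S i|.
Proof. by rewrite Ex_sum; apply: eq_bigr => i _; apply: Ex_superset. Qed.

Lemma Ex_nb_contained_sqr :
  Ex (fun E => nb_contained E ^+ 2) = \sum_i \sum_j p ^+ #|S i :|: S j|.
Proof.
transitivity (Ex (fun E => \sum_i \sum_j (S i :|: S j \subset E)%:R)).
  apply: eq_bigr => E _; congr (_ * _); rewrite expr2 /nb_contained mulr_suml.
  apply: eq_bigr => i _; rewrite mulr_sumr; apply: eq_bigr => j _.
  by rewrite subUset -natrM mulnb.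
rewrite Ex_sum; apply: eq_bigr => i _; rewrite Ex_sum; apply: eq_bigr => j _.
exact: Ex_superset.
Qed.

Lemma nb_contained_eq0 E :
  (nb_contained E == 0) = [forall i, ~~ (S i \subset E)].
Proof.
rewrite psumr_eq0 => [|i _]; last exact: ler0n.
apply/allP/forallP => [none i|none i _]; last by rewrite /= (negPf (none i)).
by have := none i (mem_index_enum i); rewrite pnatr_eq0 eqb0.
Qed.

End Counting.

Hypothesis p01 : 0 <= p <= 1.

Lemma bernoulli_ge0 E : 0 <= bernoulli E.
Proof. by have /andP[p0 p1] := p01; rewrite mulr_ge0 ?exprn_ge0 // subr_ge0. Qed.

Lemma Pr_ge0 Q : 0 <= Pr Q.
Proof. by apply: sumr_ge0 => E _; apply: bernoulli_ge0. Qed.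

Lemma Pr_le Q Q' : (forall E, Q E -> Q' E) -> Pr Q <= Pr Q'.
Proof.
move=> QQ'; rewrite /Pr [leLHS]big_mkcond [leRHS]big_mkcond; apply: ler_sum => E _.
by case: ifP => [/QQ' -> //|_]; case: ifP => // _; apply: bernoulli_ge0.
Qed.

Lemma Pr_union_bound (I : finType) (P : pred I) (Q' : I -> pred {set T}) Q :
  (forall E, Q E -> exists2 i, P i & Q' i E) -> Pr Q <= \sum_(i | P i) Pr (Q' i).
Proof.
move=> sub_Q; rewrite /Pr big_mkcond.
rewrite [leRHS](eq_bigr (fun i => \sum_E (if Q' i E then bernoulli E else 0)));
  last by move=> i _; rewrite big_mkcond.
rewrite exchange_big; apply: ler_sum => E _.
have ge0 i : 0 <= if Q' i E then bernoulli E else 0 by case: ifP; rewrite ?bernoulli_ge0.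
case: ifP => [/sub_Q[i Pi Q'i]|_]; last by apply: sumr_ge0.
by rewrite (bigD1 i) //= Q'i lerDl sumr_ge0.
Qed.

Lemma Pr_first_moment (I : finType) (P : pred I) (S : I -> {set T}) Q :
  (forall E, Q E -> exists2 i, P i & S i \subset E) -> Pr Q <= \sum_(i | P i) p ^+ #|S i|.
Proof.
move=> /(Pr_union_bound (Q' := fun i E => S i \subset E)) /le_trans; apply.
by apply: ler_sum => i _; rewrite Pr_superset.
Qed.

Lemma Pr_card_setI_ge (D : {set T}) q :
  Pr (fun E => (q <= #|E :&: D|)%N) <= 'C(#|D|, q)%:R * p ^+ q.
Proof.
have q_subset E : (q <= #|E :&: D|)%N ->
    exists2 S : {set T}, (S \subset D) && (#|S| == q) & S \subset E.
  rewrite -bin_gt0 -cards_draws card_gt0 => /set0Pn[S]; rewrite inE subsetI.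
  by case/andP=> /andP[SE SD] Sq; exists S; rewrite ?SD.
apply: le_trans (Pr_first_moment q_subset) _.
rewrite (eq_bigr (fun=> p ^+ q)) => [|S /andP[_ /eqP-> //]].
by rewrite sumr_const -cards_draws cardsE mulr_natl.
Qed.

Lemma Pr_second_moment X :
  Pr (fun E => X E == 0) * Ex X ^+ 2 <= Ex (fun E => X E ^+ 2) - Ex X ^+ 2.
Proof.
set mu := Ex X.
have -> : Ex (fun E => X E ^+ 2) - mu ^+ 2 = Ex (fun E => (X E - mu) ^+ 2).
  rewrite [RHS](eq_bigr (fun E => bernoulli E * X E ^+ 2 +
    (- (2 * mu)) * (bernoulli E * X E) + mu ^+ 2 * bernoulli E)) => [|E _]; last by ring.
  rewrite !big_split /= -!mulr_sumr -/(Ex X) -/mu -/(Ex (fun E => X E ^+ 2)).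
  by rewrite sum_bernoulli; ring.
rewrite /Pr mulr_suml /Ex big_mkcond; apply: ler_sum => E _.
have [->|_] := eqVneq (X E) 0; first by rewrite sub0r sqrrN.
by rewrite mulr_ge0 ?bernoulli_ge0 // sqr_ge0.
Qed.

End Bernoulli.

(** * The binomial random graph *)

Section RandomGraph.
Variable n : nat.
Implicit Types (E : {set epair n}) (S : {set 'I_n}) (i j : 'I_n).

Lemma gadj_simple E : simple_graph (gadj E).
Proof.
split=> [i j|i]; first by apply: eq_existsb => u; rewrite orbC.
apply/existsP => -[u /andP[_]]; rewrite orbb => /andP[/eqP ui /eqP uj].
by have := valP u; rewrite /= ui uj ltnn.
Qed.

Lemma gadj_lt E i j : i < j -> gadj E i j = [exists u in E, val u == (i, j)].
Proof.
move=> ltij; apply: eq_existsb => u; congr (_ && _).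
rewrite -pair_eqE /= /pair_eq /=; case: ((_ == i) && _) => //=.
apply/negP => /andP[/eqP uj /eqP ui]; have := valP u.
by rewrite /= ui uj ltnNge ltnW.
Qed.

Definition inner_pairs S : {set epair n} :=
  [set u | ((val u).1 \in S) && ((val u).2 \in S)].

Lemma card_inner_pairs S : #|inner_pairs S| <= #|S| * #|S|.
Proof.
rewrite -cardsX -(card_imset _ val_inj); apply: subset_leq_card.
by apply/subsetP => _ /imsetP[u + ->]; rewrite !inE.
Qed.

Lemma degree_sum_gadj E S : degree_sum (gadj E) S = 2 * #|E :&: inner_pairs S|.
Proof.
rewrite (degree_sum_oriented (gadj_simple E) S (@ord_inj n)).
rewrite -[in RHS](card_imset _ val_inj); congr (2 * _).
apply: eq_card => -[i j]; rewrite !inE /=.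
apply/and3P/imsetP => [[/andP[iS jS] ltij]|[u]].
  rewrite gadj_lt // => /exists_inP[u uE /eqP u_ij].
  by exists u; rewrite // !inE uE u_ij iS.
rewrite !inE => /and3P[uE iS jS] u_ij.
have /= iE := congr1 fst u_ij; have /= jE := congr1 snd u_ij.
have ltij : i < j by rewrite iE jE (valP u).
rewrite iE jE iS jS -iE -jE ltij gadj_lt //; split=> //.
by apply/exists_inP; exists u => //; apply/eqP.
Qed.

Local Open Scope ring_scope.
Variables (R : realFieldType) (p : R).
Hypothesis p01 : 0 <= p <= 1.

Lemma Pr_dense_set w q :
  Pr p (fun E => [exists S : {set 'I_n},
                   (#|S| == w) && (2 * q <= degree_sum (gadj E) S)%N]) <=
  (n ^ w * (w * w) ^ q)%N%:R * p ^+ q.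
Proof.
have [p0 _] := andP p01.
apply: le_trans (Pr_union_bound (P := fun S => #|S| == w)
  (Q' := fun S E => (q <= #|E :&: inner_pairs S|)%N) p01 _) _ => [E|].
  case/existsP=> S /andP[Sw]; rewrite degree_sum_gadj leq_pmul2l // => qS.
  by exists S.
apply: (@le_trans _ _ (\sum_(S : {set 'I_n} | #|S| == w) ((w * w) ^ q)%N%:R * p ^+ q)).
  apply: ler_sum => S /eqP Sw; apply: le_trans (Pr_card_setI_ge p01 _ _) _.
  rewrite ler_wpM2r ?exprn_ge0 // ler_nat (leq_trans _ (bin_leq_exp _ _)) //.
  by rewrite leq_bin2l // -Sw card_inner_pairs.
rewrite sumr_const -[leLHS]mulr_natl mulrA -natrM ler_wpM2r ?exprn_ge0 //.
rewrite ler_nat leq_mul2r -(cardsE (fun S => #|S| == w)) card_draws card_ord.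
by rewrite bin_leq_exp orbT.
Qed.

End RandomGraph.

Section CopyEdges.
Variables (U : finType) (e : rel U) (n : nat).
Hypothesis simple_e : simple_graph e.
Implicit Types (f g : U -> 'I_n) (E : {set epair n}).

(* The pairs of [epair n] are increasing, so an edge {x, y} of U contributes one pair,
   through either (x, y) or (y, x). *)
Definition copy_edges f : {set epair n} :=
  [set u | [exists d : U * U, e d.1 d.2 && (val u == (f d.1, f d.2))]].

Lemma gadj_of_copy_edges f E x y : injective f ->
  copy_edges f \subset E -> e x y -> gadj E (f x) (f y).
Proof.
move=> f_inj /subsetP sub_E; have [sym_e irr_e] := simple_e.
have adj_lt a c : e a c -> f a < f c -> gadj E (f a) (f c).
  move=> eac lt_ac; rewrite gadj_lt //; apply/exists_inP.
  exists (Sub (f a, f c) lt_ac : epair n) => //.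
  by apply: sub_E; rewrite inE; apply/existsP; exists (a, c); rewrite eac /=.
move=> exy; have [lt|lt|/val_inj/f_inj xy] := ltngtP (f x) (f y); first exact: adj_lt.
  by rewrite (gadj_simple E).1; apply: adj_lt; rewrite // sym_e.
by rewrite xy irr_e in exy.
Qed.

Lemma degree_sum_copy_edgesI f g : injective f ->
  (forall x y, f x = g y -> x = y) ->
  degree_sum e [set x | f x == g x] = 2 * #|copy_edges f :&: copy_edges g|.
Proof.
move=> f_inj fg.
have rank_inj : injective (fun x => val (f x)) by move=> x y /val_inj/f_inj.
rewrite (degree_sum_oriented simple_e _ rank_inj) -[in RHS](card_imset _ val_inj).
have ff_inj : injective (fun d : U * U => (f d.1, f d.2)).
  by move=> [x y] [x' y'] [/f_inj -> /f_inj ->].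
rewrite -[in LHS](card_imset _ ff_inj); congr (2 * _); apply: eq_card => ij.
apply/imsetP/imsetP => [[d]|[u]]; rewrite !inE.
  case/andP=> /andP[/eqP fg1 /eqP fg2] /andP[lt_d ed] ->.
  exists (Sub (f d.1, f d.2) lt_d : epair n) => //.
  by rewrite !inE; apply/andP; split; apply/existsP; exists d; rewrite ed /= -?fg1 -?fg2.
case/andP=> /existsP[d /andP[ed /eqP ud]] /existsP[d' /andP[_ /eqP ud']] ->.
exists d => //; have := valP u; rewrite ud /= !inE => ->; rewrite ed.
move: ud'; rewrite ud => -[fg1 fg2].
by rewrite {2}(fg _ _ fg1) -fg1 {2}(fg _ _ fg2) -fg2 !eqxx.
Qed.

End CopyEdges.

Section PartiteCopies.
Variables (U : finType) (e : rel U) (s n : nat) (node : U * 'I_s -> 'I_n).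
Hypotheses (simple_e : simple_graph e) (node_inj : injective node).
Implicit Types (x y : {ffun U -> 'I_s}) (A : {set U}).

(* Every vertex a of U is placed in its own block of s vertices, so that two placed
   copies of U overlap exactly in the image of the vertices placed alike. *)
Definition place x (a : U) : 'I_n := node (a, x a).

Definition agree x y : {set U} := [set a | x a == y a].

Lemma place_inj x : injective (place x).
Proof. by move=> a c /node_inj[]. Qed.

Lemma card_placed_edgesI x y :
  #|copy_edges e (place x) :&: copy_edges e (place y)| = nedges_in e (agree x y).
Proof.
have -> : agree x y = [set a | place x a == place y a].
  by apply/setP => a; rewrite !inE (inj_eq node_inj) xpair_eqE eqxx.
rewrite /nedges_in degree_sum_copy_edgesI ?mulKn //; first exact: place_inj.
by move=> a c /node_inj[].
Qed.

Lemma card_placed_edges x : #|copy_edges e (place x)| = nedges_in e setT.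
Proof.
rewrite -[copy_edges e _]setIid card_placed_edgesI; congr (nedges_in e _).
by apply/setP => a; rewrite !inE eqxx.
Qed.

Lemma card_placed_edgesU x y :
  #|copy_edges e (place x) :|: copy_edges e (place y)| =
    2 * nedges_in e setT - nedges_in e (agree x y).
Proof. by rewrite cardsU card_placed_edgesI !card_placed_edges mul2n addnn. Qed.

Lemma card_agree_with x A :
  #|[set y | A \subset agree x y]| * s ^ #|A| = s ^ #|U|.
Proof.
pose F a : pred 'I_s := if a \in A then pred1 (x a) else predT.
have -> : #|[set y | A \subset agree x y]| = #|family F|.
  apply: eq_card => y; rewrite inE; apply/subsetP/familyP => agree_y a; last first.
    by move=> aA; have := agree_y a; rewrite inE /F aA inE eq_sym.
  by rewrite /F; case: ifP => // /agree_y; rewrite !inE eq_sym.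
rewrite card_family foldrE big_image /= (bigID (mem A)) /= big1 => [|a aA].
  rewrite mul1n (eq_bigr (fun=> s)) => [|a /negPf aA]; last first.
    by rewrite /F aA -[RHS]card_ord; apply: eq_card.
  rewrite prod_nat_const -expnD -[in RHS](cardsC A) addnC; congr (s ^ (_ + _)).
  by apply: eq_card => a; rewrite inE.
by rewrite /F aA card1.
Qed.

Lemma card_agree_eq A :
  #|[set xy | agree xy.1 xy.2 == A]| * s ^ #|A| <= s ^ (2 * #|U|).
Proof.
have -> : #|[set xy | agree xy.1 xy.2 == A]| = \sum_x #|[set y | agree x y == A]|.
  rewrite -sum1_card (eq_bigl (fun xy => agree xy.1 xy.2 == A)) => [|xy]; last first.
    by rewrite inE.
  rewrite -(pair_big_dep predT (fun x y => agree x y == A) (fun _ _ => 1)) /=.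
  by apply: eq_bigr => x _; rewrite sum1_card cardsE.
apply: (@leq_trans (\sum_(x : {ffun U -> 'I_s}) s ^ #|U|)); last first.
  by rewrite sum_nat_const card_ffun card_ord -expnD addnn mul2n.
rewrite big_distrl; apply: leq_sum => x _; rewrite -(card_agree_with x A) leq_mul2r.
by apply/orP; right; apply: subset_leq_card; apply/subsetP => y; rewrite !inE => /eqP ->.
Qed.

Local Open Scope ring_scope.
Variables (R : realFieldType) (p : R).
Hypothesis p01 : 0 < p <= 1.

Let m := nedges_in e setT.

Definition nb_placed : {set epair n} -> R :=
  nb_contained R (fun x : {ffun U -> 'I_s} => copy_edges e (place x)).

Lemma Ex_nb_placed : Ex p nb_placed = s%:R ^+ #|U| * p ^+ m.
Proof.
rewrite Ex_nb_contained (eq_bigr (fun=> p ^+ m)) => [|x _]; last first.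
  by rewrite card_placed_edges.
by rewrite sumr_const card_ffun card_ord -[LHS]mulr_natl natrX.
Qed.

Lemma Var_nb_placed_le :
  Ex p (fun E => nb_placed E ^+ 2) - Ex p nb_placed ^+ 2 <=
  \sum_(A | (0 < nedges_in e A)%N)
     #|[set xy | agree xy.1 xy.2 == A]|%:R * p ^+ (2 * m - nedges_in e A).
Proof.
have [p0 _] := andP p01; rewrite Ex_nb_contained_sqr Ex_nb_placed.
have -> : (s%:R ^+ #|U| * p ^+ m) ^+ 2 =
    \sum_(x : {ffun U -> 'I_s}) \sum_(y : {ffun U -> 'I_s}) p ^+ (2 * m).
  rewrite !sumr_const card_ffun card_ord -mulrnA -[RHS]mulr_natl natrM natrX.
  by rewrite exprMn expr2 -exprM [(m * 2)%N]mulnC.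
rewrite -sumrB (eq_bigr (fun x : {ffun U -> 'I_s} => \sum_(y : {ffun U -> 'I_s})
  (p ^+ (2 * m - nedges_in e (agree x y)) - p ^+ (2 * m)))) => [|x _]; last first.
  by rewrite -sumrB; apply: eq_bigr => y _; rewrite card_placed_edgesU.
rewrite pair_big (partition_big (fun xy => agree xy.1 xy.2) predT) //= [leRHS]big_mkcond.
apply: ler_sum => A _.
rewrite (eq_bigr (fun=> p ^+ (2 * m - nedges_in e A) - p ^+ (2 * m))) => [|xy /eqP -> //].
rewrite sumr_const cardsE mulr_natl; case: posnP => [->|_].
  by rewrite subn0 subrr mul0rn.
by apply: ler_wMn2r; rewrite gerBl exprn_ge0 // ltW.
Qed.

Lemma agree_eq_weight_le A (L : R) : 0 < L -> L <= s%:R ^+ #|A| * p ^+ nedges_in e A ->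
  #|[set xy | agree xy.1 xy.2 == A]|%:R * p ^+ (2 * m - nedges_in e A) <=
  Ex p nb_placed ^+ 2 / L.
Proof.
move=> L0 dense; have [p0 _] := andP p01; set N := #|_|; set l := nedges_in e A in dense *.
rewrite ler_pdivlMr // Ex_nb_placed.
apply: (@le_trans _ _ (N%:R * p ^+ (2 * m - l) * (s%:R ^+ #|A| * p ^+ l))).
  by rewrite ler_wpM2l // mulr_ge0 ?ler0n ?exprn_ge0 // ltW.
have lm : (l <= 2 * m)%N.
  by apply: leq_trans (leq_pmull _ _); rewrite ?nedges_inS ?subsetT.
rewrite mulrACA -exprD subnK // -natrX -natrM exprMn -!exprM [(m * 2)%N]mulnC.
rewrite ler_wpM2r ?exprn_ge0 ?(ltW p0) // -natrX ler_nat [(#|U| * 2)%N]mulnC.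
exact: card_agree_eq.
Qed.

Lemma Pr_no_placed_copy (L : R) : 0 < L -> (0 < s)%N ->
  (forall A, (0 < nedges_in e A)%N -> L <= s%:R ^+ #|A| * p ^+ nedges_in e A) ->
  Pr p (fun E => [forall x, ~~ (copy_edges e (place x) \subset E)]) <= 2 ^+ #|U| / L.
Proof.
move=> L0 s0 dense; have [p0 p1] := andP p01; have p01' : 0 <= p <= 1 by rewrite ltW.
have mean2_gt0 : 0 < Ex p nb_placed ^+ 2.
  by rewrite Ex_nb_placed exprn_gt0 // mulr_gt0 ?exprn_gt0 ?ltr0n.
rewrite -(ler_pM2r mean2_gt0).
apply: le_trans (_ : Pr p (fun E => nb_placed E == 0) * Ex p nb_placed ^+ 2 <= _).
  rewrite ler_wpM2r ?(ltW mean2_gt0) //; apply: Pr_le => // E.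
  by rewrite /nb_placed nb_contained_eq0.
apply: le_trans (Pr_second_moment p01' nb_placed) _; apply: le_trans Var_nb_placed_le _.
apply: (@le_trans _ _ (\sum_(A : {set U}) Ex p nb_placed ^+ 2 / L)); last first.
  have card_sets : #|{set U}| = (2 ^ #|U|)%N.
    by rewrite -[#|U|]cardsT -card_powerset powersetT cardsT.
  by rewrite sumr_const card_sets -[leLHS]mulr_natl natrX mulrA mulrAC.
rewrite big_mkcond; apply: ler_sum => A _; case: ifP => [A0|_].
  by apply: agree_eq_weight_le => //; apply: dense.
by rewrite divr_ge0 ?ltW.
Qed.

End PartiteCopies.

(** * Both sides of the threshold *)

Lemma exists_min_winning_tree (b : nat) (VH : finType) (eH : rel VH) x :
  is_forest eH ->
  exists (VT : finType) (eT : rel VT), min_winning_tree b eH (component eH x) eT.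
Proof.
move=> forestH.
have [VT [eT [treeT winT]]] :=
  exists_winning_tree b forestH (component_connected forestH.1 x).
apply: NNPP => no_min; have [n] := ubnP #|VT|.
elim: n VT eT treeT winT => // n IH VT eT treeT winT VTn.
apply: no_min; exists VT, eT; split=> // VT' eT' treeT' winT'.
by rewrite leqNgt; apply/negP => lt_VT; apply: IH treeT' winT' (leq_trans lt_VT VTn).
Qed.

Section ProbabilityBounds.
Local Open Scope ring_scope.
Variable R : realFieldType.
Variables (b : nat) (VH : finType) (eH : rel VH).
Hypothesis simple_eH : simple_graph eH.
Implicit Types (p L eps : R) (n v : nat).

Lemma expr_minn_le n v w p eps : (1 < v)%N -> (0 < n)%N -> (0 < w <= v)%N ->
  0 <= p -> 0 <= eps <= 1 -> n%:R ^+ v * p ^+ v.-1 <= eps ^+ v.-1 ->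
  n%:R ^+ w * p ^+ minn w v.-1 <= eps.
Proof.
move=> v1 n0 /andP[w0 le_wv] p0 /andP[eps0 eps1] small; have v'0 : (0 < v.-1)%N by lia.
have [lt_wv|le_vw] := ltnP w v; last first.
  have -> : w = v by apply/eqP; rewrite eqn_leq le_wv.
  have -> : minn v v.-1 = v.-1 by lia.
  by apply: (le_trans small); rewrite -[leRHS]expr1 ler_wiXn2l.
have np_small : n%:R * p <= eps.
  rewrite -(ler_pXn2r v'0) ?nnegrE ?mulr_ge0 ?ler0n // exprMn (le_trans _ small) //.
  by rewrite ler_wpM2r ?exprn_ge0 // ler_weXn2l ?ler1n // leq_pred.
have -> : minn w v.-1 = w by lia.
rewrite -exprMn -[leRHS]expr1; apply: le_trans (_ : eps ^+ w <= _).
  by rewrite lerXn2r ?nnegrE ?mulr_ge0 ?ler0n.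
by rewrite ler_wiXn2l.
Qed.

Lemma Pr_client_wins_le x n v p eps : (1 < v)%N ->
  winning_trees_geq b eH (component eH x) v ->
  (0 < n)%N -> 0 <= p <= 1 -> 0 <= eps <= 1 -> n%:R ^+ v * p ^+ v.-1 <= eps ^+ v.-1 ->
  Pr p (fun E : {set epair n} => client_wins b eH setT (gadj E)) <=
    (v * (v * v) ^ v)%N%:R * eps.
Proof.
move=> v1 min_v n0 p01 eps01 small; have [p0 _] := andP p01; have [eps0 _] := andP eps01.
pose dense (w : 'I_v) (E : {set epair n}) := [exists S : {set 'I_n},
  (#|S| == w.+1) && (2 * minn w.+1 v.-1 <= degree_sum (gadj E) S)%N].
apply: le_trans (Pr_union_bound (P := predT) (Q' := dense) p01 _) _ => [E|].
  move=> winE; apply/exists_inP; apply: contraLR winE.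
  rewrite negb_exists_in => /forall_inP sparse.
  apply: not_client_wins_sparse simple_eH min_v (ltnW v1) (gadj_simple E) _.
  move=> S /andP[S0 Sv].
  have wv : (#|S|.-1 < v)%N by rewrite prednK.
  have /existsPn/(_ S) := sparse (Ordinal wv) isT.
  by rewrite /= prednK // eqxx /= -ltnNge.
apply: (@le_trans _ _ (\sum_(w < v) ((v * v) ^ v)%N%:R * eps)); last first.
  by rewrite sumr_const card_ord -[leLHS]mulr_natl natrM mulrA.
apply: ler_sum => w _; apply: le_trans (Pr_dense_set n p01 w.+1 (minn w.+1 v.-1)) _.
rewrite mulnC natrM -mulrA; apply: ler_pM; rewrite ?mulr_ge0 ?exprn_ge0 ?ler0n //.
  rewrite ler_nat (@leq_trans ((v * v) ^ minn w.+1 v.-1)) //.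
    by rewrite leq_exp2r ?leq_mul ?ltn_ord // leq_min ltn0Sn -subn1 subn_gt0.
  by rewrite leq_pexp2l ?muln_gt0 ?(ltnW v1) // geq_min ltn_ord.
by rewrite natrX expr_minn_le // ltn_ord.
Qed.

Lemma le_expr_of_density v a m s p L : (1 < v)%N -> 0 < p -> 1 <= L -> 1 <= s ->
  (0 < m)%N -> (v * m <= v.-1 * a)%N -> L ^+ v.-1 <= s ^+ v * p ^+ v.-1 ->
  L <= s ^+ a * p ^+ m.
Proof.
move=> v1 p0 L1 s1 m0 sparse Lsp; have v'0 : (0 < v.-1)%N by lia.
have s0 : 0 < s by apply: lt_le_trans s1.
have L0 : 0 <= L by apply: le_trans L1.
rewrite -(ler_pXn2r v'0) ?nnegrE ?mulr_ge0 ?exprn_ge0 ?(ltW p0) ?(ltW s0) //.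
apply: (le_trans Lsp).
have sp1 : 1 <= s ^+ v * p ^+ v.-1 by apply: le_trans Lsp; apply: exprn_ege1.
apply: (@le_trans _ _ ((s ^+ v * p ^+ v.-1) ^+ m)).
  by rewrite -[leLHS]expr1 ler_weXn2l.
rewrite !exprMn -!exprM [(m * _)%N]mulnC ler_wpM2r ?exprn_ge0 ?(ltW p0) //.
by rewrite ler_weXn2l // [(a * _)%N]mulnC.
Qed.

Lemma floor_expr_ge n k v p L : (1 < v)%N -> 0 <= p -> 0 <= L -> (k < n)%N ->
  ((2 * k.+1)%N%:R ^+ v * L) ^+ v.-1 <= n%:R ^+ v * p ^+ v.-1 ->
  L ^+ v.-1 <= (n %/ k.+1)%N%:R ^+ v * p ^+ v.-1.
Proof.
move=> v1 p0 L0 kn; set c := (2 * k.+1)%N%:R : R.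
have cv_gt0 : 0 < c ^+ v by rewrite exprn_gt0 // ltr0n.
have ns : n%:R <= (n %/ k.+1)%N%:R * c.
  rewrite -natrM ler_nat; have := divn_eq n k.+1; have := ltn_pmod n (ltn0Sn k).
  have : (0 < n %/ k.+1)%N by rewrite divn_gt0.
  by nia.
move=> big; rewrite -(ler_pM2l cv_gt0); apply: (@le_trans _ _ (n%:R ^+ v * p ^+ v.-1)).
  apply: le_trans big; rewrite exprMn ler_wpM2r ?exprn_ge0 // -[leLHS]expr1.
  by rewrite ler_weXn2l ?exprn_ege1 ?ler1n //; lia.
rewrite mulrA ler_wpM2r ?exprn_ge0 // -exprMn lerXn2r ?nnegrE ?mulr_ge0 ?ler0n //.
by rewrite mulrC.
Qed.

Lemma Pr_not_client_wins_le (VT : VH -> finType) (eT : forall x, rel (VT x)) v :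
  (1 < v)%N -> (forall x, is_tree (@eT x)) -> (forall x, (#|VT x| <= v)%N) ->
  (forall x, client_wins b eH (component eH x) (@eT x)) ->
  exists k : nat, forall n p L, 0 < p <= 1 -> 1 <= L -> (k < n)%N ->
    ((2 * k.+1)%N%:R ^+ v * L) ^+ v.-1 <= n%:R ^+ v * p ^+ v.-1 ->
    Pr p (fun E : {set epair n} => ~~ client_wins b eH setT (gadj E)) <= 2 ^+ k / L.
Proof.
move=> v1 treeT VTv winT; have [N winN] := client_wins_disjoint_union simple_eH winT.
pose U : finType := {i : VH * 'I_N & VT i.1}.
pose e : rel U := disjoint_union (fun i : VH * 'I_N => @eT i.1).
have simple_e : simple_graph e.
  by apply: disjoint_union_simple => i; case: (treeT i.1) => -[].
exists #|U| => n p L p01 L1 kn big; have [p0 p1] := andP p01; set s := (n %/ #|U|.+1)%N.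
have L0 : 0 < L by apply: lt_le_trans L1.
have s0 : (0 < s)%N by rewrite divn_gt0.
have sn : (#|{: U * 'I_s}| <= n)%N.
  rewrite card_prod card_ord (leq_trans _ (leq_divM n #|U|.+1)) //.
  by rewrite mulnC leq_mul2l leqnSn orbT.
pose node (a : U * 'I_s) : 'I_n := widen_ord sn (enum_rank a).
have node_inj : injective node by move=> a c /(congr1 val) /= /val_inj/enum_rank_inj.
apply: le_trans (Pr_no_placed_copy simple_e node_inj p01 L0 s0 _).
  apply: Pr_le => [|E]; first by rewrite ltW.
  apply: contraR; rewrite negb_forall => /existsP[x]; rewrite negbK => sub_E.
  have x_inj : injective (place node x) by apply: place_inj.
  apply: (client_wins_hom x_inj _ winN).
  by move=> a c; apply: gadj_of_copy_edges.
move=> A A0; apply: (le_expr_of_density v1 p0 L1 _ A0); rewrite ?ler1n //.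
  have density := disjoint_union_density A (fun i => (treeT i.1).1) (fun i => VTv i.1).
  rewrite -(leq_pmul2l (ltn0Sn 1)) mulnCA [leqRHS]mulnA; apply: leq_trans density.
  by rewrite leq_mul2l mulnC leq_divM orbT.
exact: floor_expr_ge v1 (ltW p0) (ltW L0) kn big.
Qed.

End ProbabilityBounds.

Section WithHighProbability.
Local Open Scope ring_scope.
Implicit Types (p : nat -> R) (n v : nat).

Lemma gnp_probE n (p : R) (Q : pred {set epair n}) : gnp_prob p Q = Pr p Q.
Proof.
rewrite /gnp_prob /Pr; apply: eq_bigr => E _.
by rewrite /bernoulli cardsT !RpowE.
Qed.

Lemma prob_bounds_itv p n : prob_bounds p -> 0 <= p n <= 1.
Proof. by case/(_ n) => /RleP -> /RleP ->. Qed.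

Lemma whp_of_Pr_compl (Q : forall n, pred {set epair n}) p : prob_bounds p ->
  (forall eps : R, 0 < eps -> exists N, forall n, (N <= n)%N ->
     Pr (p n) (predC (Q n)) <= eps) -> whp Q p.
Proof.
move=> p01 small eps /RltP eps0.
have [|N smallN] := small (eps / 2); first by rewrite divr_gt0.
exists N => n /ssrnat.leP Nn; apply/RltP; rewrite RdistE gnp_probE Pr_compl.
rewrite (_ : _ - _ = - Pr (p n) (predC (Q n))); last by rewrite addrAC -R1E subrr sub0r.
rewrite normrN ger0_norm ?Pr_ge0 ?prob_bounds_itv //; apply: le_lt_trans (smallN n Nn) _.
by rewrite ltr_pdivrMr // ltr_pMr // ltr1n.
Qed.

Lemma threshold_gt0 v e n : 0 < threshold v e n.
Proof. by apply/RltP; apply: exp_pos. Qed.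

Lemma threshold_expr v e n :
  (0 < e)%N -> (0 < n)%N -> n%:R ^+ v * threshold v e n ^+ e = 1.
Proof.
move=> e0 n0; have nR : Rlt R0 (INR n) by apply: lt_0_INR; apply/ssrnat.ltP.
have eR : INR e <> R0 by apply: not_0_INR; move: e0; case: (e).
have -> : threshold v e n ^+ e = Rinv (INR n ^+ v).
  rewrite -!RpowE -Rpower_pow; last exact: exp_pos.
  rewrite /threshold Rpower_mult -Rpower_pow // -Rpower_Ropp; congr Rpower.
  by rewrite /Rdiv Ropp_mult_distr_l_reverse Rmult_assoc Rinv_l // Rmult_1_r.
by rewrite INRE RinvE mulfV // expf_neq0 // pnatr_eq0 -lt0n.
Qed.

Lemma expr_le_threshold v e n (x c : R) : (0 < e)%N -> (0 < n)%N ->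
  0 <= x -> x <= c * threshold v e n -> n%:R ^+ v * x ^+ e <= c ^+ e.
Proof.
move=> e0 n0 x0 le_x; rewrite -[leRHS]mulr1 -[X in _ <= _ * X](threshold_expr v e0 n0).
rewrite mulrCA -exprMn ler_wpM2l ?exprn_ge0 ?ler0n //.
by rewrite lerXn2r ?nnegrE // (le_trans x0).
Qed.

Lemma expr_ge_threshold v e n (x c : R) : (0 < e)%N -> (0 < n)%N ->
  0 <= c -> c * threshold v e n <= x -> c ^+ e <= n%:R ^+ v * x ^+ e.
Proof.
move=> e0 n0 c0 ge_x; rewrite -[leLHS]mulr1 -[X in _ * X <= _](threshold_expr v e0 n0).
have ct0 : 0 <= c * threshold v e n by rewrite mulr_ge0 // ltW ?threshold_gt0.
rewrite mulrCA -exprMn ler_wpM2l ?exprn_ge0 ?ler0n //.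
by rewrite lerXn2r ?nnegrE // (le_trans ct0).
Qed.

Lemma little_o_le p v e : little_o p (threshold v e) ->
  forall c : R, 0 < c -> exists N, forall n, (N <= n)%N -> p n <= c * threshold v e n.
Proof.
move=> p_o c /RltP c0; have [N leN] := p_o c c0; exists N => n Nn.
exact/RleP/leN.
Qed.

Lemma little_omega_ge p v e : little_omega p (threshold v e) ->
  forall c : R, 0 < c -> exists N, forall n, (N <= n)%N -> c * threshold v e n <= p n.
Proof.
move=> p_omega c /RltP c0; have [N leN] := p_omega c c0; exists N => n Nn.
exact/RleP/leN.
Qed.

Variables (b : nat) (VH : finType) (eH : rel VH).
Hypothesis simple_eH : simple_graph eH.

Lemma waiter_wins_whp x v p : (1 < v)%N ->
  winning_trees_geq b eH (component eH x) v ->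
  prob_bounds p -> little_o p (threshold v v.-1) ->
  whp (fun n (E : {set epair n}) => ~~ client_wins b eH setT (gadj E)) p.
Proof.
move=> v1 min_v p01 p_o; apply: whp_of_Pr_compl => // eps eps0.
have v'0 : (0 < v.-1)%N by lia.
pose K : R := (v * (v * v) ^ v)%N%:R.
have K0 : 0 < K by rewrite ltr0n !muln_gt0 expn_gt0 muln_gt0; lia.
pose d : R := Num.min 1 (eps / K).
have d0 : 0 < d by rewrite lt_min ltr01 divr_gt0.
have d1 : d <= 1 by rewrite ge_min lexx.
have [N small_p] := little_o_le p_o d0.
exists N.+1 => n Nn; have n0 : (0 < n)%N by apply: leq_trans Nn.
have [p0 _] := andP (prob_bounds_itv n p01); have p_small := small_p n (ltnW Nn).
apply: (@le_trans _ _ (K * d)); last by rewrite mulrC -ler_pdivlMr // ge_min lexx orbT.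
apply: le_trans (_ : Pr (p n) (fun E => client_wins b eH setT (gadj E)) <= _).
  by apply: Pr_le => [|E /=]; rewrite ?prob_bounds_itv ?negbK.
apply: (Pr_client_wins_le simple_eH v1 min_v n0); rewrite ?prob_bounds_itv ?(ltW d0) //.
exact: expr_le_threshold v'0 n0 p0 p_small.
Qed.

Lemma client_wins_whp (VT : VH -> finType) (eT : forall x, rel (VT x)) v p :
  (1 < v)%N -> (forall x, is_tree (@eT x)) -> (forall x, (#|VT x| <= v)%N) ->
  (forall x, client_wins b eH (component eH x) (@eT x)) ->
  prob_bounds p -> little_omega p (threshold v v.-1) ->
  whp (fun n (E : {set epair n}) => client_wins b eH setT (gadj E)) p.
Proof.
move=> v1 treeT VTv winT p01 p_omega; apply: whp_of_Pr_compl => // eps eps0.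
have v'0 : (0 < v.-1)%N by lia.
have [k small_Pr] := Pr_not_client_wins_le R simple_eH v1 treeT VTv winT.
pose L : R := Num.max 1 (2 ^+ k / eps).
have L1 : 1 <= L by rewrite le_max lexx.
have L0 : 0 < L by apply: lt_le_trans L1.
pose c : R := (2 * k.+1)%N%:R ^+ v * L.
have c0 : 0 < c by rewrite mulr_gt0 // exprn_gt0 // ltr0n.
have [N large_p] := little_omega_ge p_omega c0.
exists (N + k.+1)%N => n Nkn; have kn : (k < n)%N by lia.
have n0 : (0 < n)%N by apply: leq_trans kn.
have p_large : c * threshold v v.-1 n <= p n by apply: large_p; lia.
have p_gt0 : 0 < p n <= 1.
  have [_ ->] := andP (prob_bounds_itv n p01); rewrite andbT.
  by apply: lt_le_trans p_large; rewrite mulr_gt0 ?threshold_gt0.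
apply: le_trans (small_Pr n (p n) L p_gt0 L1 kn _) _.
  exact: expr_ge_threshold v'0 n0 (ltW c0) p_large.
by rewrite ler_pdivrMr // mulrC -ler_pdivrMr // le_max lexx orbT.
Qed.

End WithHighProbability.

Theorem theorem10 :
  (* (1) trees *)
  (forall (b : nat) (VH : finType) (eH : rel VH),
      0 < b -> is_tree eH ->
      exists (VT : finType) (eT : rel VT), is_tree eT /\ client_wins b eH setT eT)
  /\
  (* (2) forests in G(n,p) *)
  (forall (b : nat) (VH : finType) (eH : rel VH),
      0 < b -> is_forest eH -> (exists x y, eH x y) ->
      forall (VT : finType) (eT : rel VT),
        (* T_max: a minimum winning tree for some component ... *)
        (exists x : VH, min_winning_tree b eH (component eH x) eT) ->
        (* ... with the maximum number of vertices among these *)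
        (forall (x : VH) (VT' : finType) (eT' : rel VT'),
            min_winning_tree b eH (component eH x) eT' -> #|VT'| <= #|VT|) ->
        forall p : nat -> R,
          prob_bounds p ->
          (little_omega p (threshold #|VT| (nedges eT)) ->
             whp (fun n E => client_wins b eH setT (gadj E)) p) /\
          (little_o p (threshold #|VT| (nedges eT)) ->
             whp (fun n E => ~~ client_wins b eH setT (gadj E)) p)).
Proof.
split=> [b VH eH _ treeH|b VH eH _ forestH [x0 [y0 exy0]] VT eT].
  exact: exists_winning_tree treeH.1 (tree_connected treeH).
move=> [x [treeT _ minT]] maxT p p01.
have /fin_all_exists[VT' /fin_all_exists[eT' minT']] z :=
  exists_min_winning_tree b z forestH.
have treeT' z : is_tree (@eT' z) by case: (minT' z).
have winT' z : client_wins b eH (component eH z) (@eT' z) by case: (minT' z).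
have VT'_le z : #|VT' z| <= #|VT| := maxT z _ _ (minT' z).
have v_gt1 : 1 < #|VT|.
  apply: leq_trans (component_card_gt1 forestH.1 exy0) _.
  exact: leq_trans (client_wins_card (winT' x0)) (VT'_le x0).
rewrite (nedges_tree treeT); split.
  exact: (client_wins_whp forestH.1 v_gt1 treeT' VT'_le winT' p01).
exact: (waiter_wins_whp forestH.1 v_gt1 minT p01).
Qed.
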